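(* Let $h$ be a Legendre-type function as in the context, $(1/\beta)$-strongly convex on $\mathcal{D}$ with respect to $\|\cdot\|_2$, with associated Legendre-type loss $S$ and decoding $d$. Let $(x_i,y_i)_{i=1}^n$ be i.i.d. from $\rho$, assume $g^\star\in\mathcal{G}$ with $\|g^\star\|_{\mathcal{G}}\le D$. Let $C^2=1+\sup_{y\in\mathcal{Y}}\|\phi(y)-\nabla h^*(0)\|_2/(\kappa\beta D)$ and run ASGD with constant step size $\eta=2/(\beta\kappa^2C^2\sqrt n)$. Then $$\mathbb{E}\big[\mathcal{E}(d\circ\widehat g_n)-\mathcal{E}(f^\star)\big]\le\frac{4\,\kappa\,c_{\psi}\,\beta\,D\,C}{n^{1/4}},\qquad c_\psi=\max_{z\in\mathcal{Z}}\|\psi(z)\|_2.$$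
   Context: $\mathcal{Y},\mathcal{Z}$ finite sets, $\mathcal{H}=\mathbb{R}^{k'}$ with Euclidean inner product, $\psi:\mathcal{Z}\to\mathcal{H}$, $\phi:\mathcal{Y}\to\mathcal{H}$, $c\in\mathbb{R}$, $L(z,y)=\langle\psi(z),\phi(y)\rangle+c$; $\mathcal{M}=\operatorname{hull}(\phi(\mathcal{Y}))$. $z(u)$ denotes an element of $\arg\min_z\langle\psi(z),u\rangle$ (fixed tie-breaking). $h:\mathcal{D}\to\mathbb{R}$ is of Legendre type (strictly convex on $\operatorname{int}\mathcal{D}$, differentiable there, with $\|\nabla h(u)\|\to\infty$ as $u\to\partial\mathcal{D}$) on a convex set $\mathcal{D}\supseteq\mathcal{M}$, and its Fenchel conjugate $h^*(v)=\sup_{u\in\mathcal{D}}\{\langle v,u\rangle-h(u)\}$ is finite and differentiable on all of $\mathcal{V}=\mathbb{R}^{k'}$. The Legendre-type loss is $S(v,y)=h^*(v)+h(\phi(y))-\langle\phi(y),v\rangle$, with decoding $d(v)=z(\nabla h^*(v))$. $\rho$ is a probability measure on $\mathcal{X}\times\mathcal{Y}$; $\mathcal{E}(f)=\mathbb{E}_\rho L(f(X),Y)$, $\mathcal{R}(g)=\mathbb{E}_\rho S(g(X),Y)$; $f^\star$ minimizes $\mathcal{E}$ over all measurable $f$ and $g^\star$ minimizes $\mathcal{R}$ over all measurable $g:\mathcal{X}\to\mathcal{V}$. $\bar{\mathcal{G}}$ is a scalar RKHS on $\mathcal{X}$ with kernel $k$, $\sup_x k(x,x)\le\kappa^2$;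 $\mathcal{G}=\bar{\mathcal{G}}^{k'}$ with $\|g\|_{\mathcal{G}}^2=\sum_{j=1}^{k'}\|g_j\|_{\bar{\mathcal{G}}}^2$. ASGD: $g_0=0$, $g_i=\Pi_D\big(g_{i-1}-\eta\nabla_v S(g_{i-1}(x_i),y_i)\otimes k(x_i,\cdot)\big)$, where $\Pi_D$ is the projection onto the ball of radius $D$ in $\mathcal{G}$, and $\widehat g_n=\frac1n\sum_{i=1}^n g_i$. *)

(* Defs.v *)
From HB Require Import structures.
From mathcomp Require Import all_boot all_order all_algebra.
From mathcomp Require Import all_classical all_reals all_analysis.
Set Implicit Arguments. Unset Strict Implicit. Unset Printing Implicit Defensive.
Import Order.TTheory GRing.Theory Num.Theory.
Import numFieldNormedType.Exports.
Local Open Scope classical_set_scope.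
Local Open Scope ring_scope.

Definition pdiscr (T : finType) (t0 : T) : Type := T.
HB.instance Definition _ (T : finType) (t0 : T) := Finite.on (pdiscr t0).
HB.instance Definition _ (T : finType) (t0 : T) :=
  isPointed.Build (pdiscr t0) t0.
HB.instance Definition _ (T : finType) (t0 : T) :=
  @isMeasurable.Build default_measure_display (pdiscr t0)
    discrete_measurable (@discrete_measurable0 _)
    (@discrete_measurableC _) (@discrete_measurableU _).

Definition dotv (R : realType) (k : nat) (u v : 'rV[R]_k) : R :=
  \sum_(i < k) u 0 i * v 0 i.
Definition norm2 (R : realType) (k : nat) (u : 'rV[R]_k) : R :=
  Num.sqrt (dotv u u).

Definition grad (R : realType) (k : nat) (f : 'rV[R]_k -> R) (u : 'rV[R]_k)
  : 'rV[R]_k := \row_(i < k) ('D_(delta_mx 0 i) f u).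

Definition hullY (R : realType) (k : nat) (Y : finType) (phi : Y -> 'rV[R]_k)
  : set 'rV[R]_k :=
  [set u | exists lam : Y -> R, (forall y, 0 <= lam y) /\
     \sum_(y : Y) lam y = 1 /\ u = \sum_(y : Y) lam y *: phi y].

Definition convex_setv (R : realType) (k : nat) (A : set 'rV[R]_k) : Prop :=
  forall u w t, A u -> A w -> 0 <= t <= 1 -> A (t *: u + (1 - t) *: w).

Definition legendre_type (R : realType) (k : nat) (Dom : set 'rV[R]_k)
  (h : 'rV[R]_k -> R) : Prop :=
  [/\ convex_setv Dom,
      (forall u w t, interior Dom u -> interior Dom w -> u != w -> 0 < t < 1 ->
         h (t *: u + (1 - t) *: w) < t * h u + (1 - t) * h w),
      (forall u, interior Dom u -> differentiable h u) &
      (forall b (u : nat -> 'rV[R]_k), closure Dom b -> ~ interior Dom b ->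
         (forall m, interior Dom (u m)) -> u @ \oo --> b ->
         (fun m => norm2 (grad h (u m))) @ \oo --> +oo)].

Definition strongly_convex_on (R : realType) (k : nat) (Dom : set 'rV[R]_k)
  (h : 'rV[R]_k -> R) (mu : R) : Prop :=
  forall u w t, Dom u -> Dom w -> 0 <= t <= 1 ->
    h (t *: u + (1 - t) *: w) <=
    t * h u + (1 - t) * h w - mu / 2 * t * (1 - t) * norm2 (u - w) ^+ 2.

Definition fconj (R : realType) (k : nat) (Dom : set 'rV[R]_k)
  (h : 'rV[R]_k -> R) (v : 'rV[R]_k) : R :=
  sup [set dotv v u - h u | u in Dom].

Definition Sloss (R : realType) (k : nat) (Y : Type) (Dom : set 'rV[R]_k)
  (h : 'rV[R]_k -> R) (phi : Y -> 'rV[R]_k) (v : 'rV[R]_k) (y : Y) : R :=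
  fconj Dom h v + h (phi y) - dotv (phi y) v.

(* z(u) in argmin_z <psi z, u>, with fixed tie-breaking given by       *)
(* Order.arg_min (z0 is an irrelevant default: a minimizer exists)     *)
Definition zdec (R : realType) (k : nat) (Z : finType) (z0 : Z)
  (psi : Z -> 'rV[R]_k) (u : 'rV[R]_k) : Z :=
  Order.arg_min z0 xpredT (fun z => dotv (psi z) u).

Definition legendre_decode (R : realType) (k : nat) (Z : finType) (z0 : Z)
  (psi : Z -> 'rV[R]_k) (Dom : set 'rV[R]_k) (h : 'rV[R]_k -> R)
  (v : 'rV[R]_k) : Z :=
  zdec z0 psi (grad (fconj Dom h) v).

Definition Lloss (R : realType) (k : nat) (Y Z : Type)
  (psi : Z -> 'rV[R]_k) (phi : Y -> 'rV[R]_k) (c : R) (z : Z) (y : Y) : R :=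
  dotv (psi z) (phi y) + c.

Definition is_rkhs (R : realType) (X : Type) (Hs : set (X -> R))
  (ip : (X -> R) -> (X -> R) -> R) (kk : X -> X -> R) : Prop :=
  [/\ Hs (fun _ => 0),
      (forall f g, Hs f -> Hs g -> Hs (fun x => f x + g x)),
      (forall (a : R) f, Hs f -> Hs (fun x => a * f x)) &
      (forall x, Hs (kk x))] /\
  [/\ (forall f g, Hs f -> Hs g -> ip f g = ip g f),
      (forall (a : R) f g h, Hs f -> Hs g -> Hs h ->
         ip (fun x => a * f x + g x) h = a * ip f h + ip g h),
      (forall f, Hs f -> 0 <= ip f f /\ (ip f f = 0 -> f = (fun _ => 0))),
      (forall f x, Hs f -> ip f (kk x) = f x) &
      (forall u : nat -> (X -> R), (forall m, Hs (u m)) ->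
         (forall e : R, 0 < e -> exists N, forall p q, (N <= p)%N -> (N <= q)%N ->
            ip (fun x => u p x - u q x) (fun x => u p x - u q x) < e) ->
         exists2 f, Hs f &
           (fun m => ip (fun x => u m x - f x) (fun x => u m x - f x))
             @ \oo --> (0 : R))].

Definition inG (R : realType) (X : Type) (k : nat) (Hs : set (X -> R))
  (g : X -> 'rV[R]_k) : Prop :=
  forall j : 'I_k, Hs (fun x => g x 0 j).

Definition normG (R : realType) (X : Type) (k : nat)
  (ip : (X -> R) -> (X -> R) -> R) (g : X -> 'rV[R]_k) : R :=
  Num.sqrt (\sum_(j < k) ip (fun x => g x 0 j) (fun x => g x 0 j)).

Definition projG (R : realType) (X : Type) (k : nat)
  (ip : (X -> R) -> (X -> R) -> R) (D : R) (g : X -> 'rV[R]_k) : X -> 'rV[R]_k :=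
  if normG ip g <= D then g else (fun x => (D / normG ip g) *: g x).

(* ASGD iterates: g_0 = 0,                                             *)
(* g_{i} = Pi_D(g_{i-1} - eta grad_v S(g_{i-1}(x_i),y_i) (x) k(x_i,.)), *)
(* where sample i (i >= 1) is s (i-1); grad_v S(v,y) = grad h^*(v) - phi y *)
Fixpoint asgd_iter (R : realType) (X Y : Type) (k : nat)
  (ip : (X -> R) -> (X -> R) -> R) (kk : X -> X -> R) (D eta : R)
  (gradS : 'rV[R]_k -> Y -> 'rV[R]_k) (s : nat -> X * Y) (i : nat)
  : X -> 'rV[R]_k :=
  match i with
  | 0 => fun _ => 0
  | m.+1 =>
    let g := asgd_iter ip kk D eta gradS s m in
    projG ip D (fun x => g x - (eta * kk (s m).1 x) *: gradS (g (s m).1) (s m).2)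
  end.

Definition asgd_avg (R : realType) (X Y : Type) (k : nat)
  (ip : (X -> R) -> (X -> R) -> R) (kk : X -> X -> R) (D eta : R)
  (gradS : 'rV[R]_k -> Y -> 'rV[R]_k) (s : nat -> X * Y) (n : nat)
  : X -> 'rV[R]_k :=
  fun x => n%:R^-1 *: \sum_(i < n) asgd_iter ip kk D eta gradS s i.+1 x.

Definition measurable_fin (d : measure_display) (X : measurableType d)
  (Z : Type) (f : X -> Z) : Prop :=
  forall A : set Z, measurable (f @^-1` A).

Definition measurable_vec (d : measure_display) (X : measurableType d)
  (R : realType) (k : nat) (g : X -> 'rV[R]_k) : Prop :=
  forall j : 'I_k, measurable_fun setT (fun x => g x 0 j).

Definition indep_first (d : measure_display) (Om : measurableType d)
  (R : realType) (P : probability Om R) (d' : measure_display)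
  (T : measurableType d') (xi : nat -> Om -> T) (n : nat) : Prop :=
  forall A : nat -> set T, (forall i, measurable (A i)) ->
    P (\bigcap_(i in [set i | (i < n)%N]) (xi i @^-1` A i)) =
    (\prod_(i < n) P (xi i @^-1` A i))%E.

(* Main.v *)
(* Let F be the Fenchel conjugate of h, which the strong convexity of h makes
   beta-smooth, and B its Bregman divergence.  Co-coercivity gives
   |grad F v - grad F w|^2 <= 2 beta B(v, w).  First-order optimality of gstar
   says that grad F (gstar x) is the conditional mean of phi(Y), so the excess
   risk of the decoding of g is at most 2 c_psi E |grad F g - grad F gstar|,
   hence at most c_psi (t + (2 beta / t) E B(g, gstar)) for every t > 0.
   Expanding the squared distance to gstar after a gradient step, which the
   projection does not increase, telescoping along a sample path, and averaging
   each step over its fresh sample bounds the sum of the E B(g_i, gstar);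
   convexity of B in its first argument transfers this to the averaged iterate.
   The choice t = 2 kappa beta D C / n^(1/4) gives the rate. *)
Require Import Defs.
From HB Require Import structures.
From mathcomp Require Import all_boot all_order all_algebra.
From mathcomp Require Import all_classical all_reals all_analysis.
From mathcomp Require Import measurable_realfun ring lra.
Set Implicit Arguments. Unset Strict Implicit. Unset Printing Implicit Defensive.
Import Order.TTheory GRing.Theory Num.Theory.
Import numFieldNormedType.Exports.
Local Open Scope classical_set_scope.
Local Open Scope ring_scope.

(** The algorithm outputs the mean of iterates 1 to [n], whereas telescoping controls iterates 0 to
    [n - 1]. The squared distance left at the end of the telescoping bounds the divergence of
    iterate [n] and pays for this shift. [C ^+ 2] is the factor by which [beta kappa D] must grow to
    bound every stochastic gradient on the ball. With the given [eta] each step then adds at most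
    [4 D^2 / n], so a whole path costs at most [D^2 + 4 D^2]. The free parameter [t] keeps the
    excess risk bound affine in the divergence, so expectations pass through it without a square
    root. Much of the length is measure theory. The inner product [ip] is abstract, so the norm that
    decides the projection is shown measurable by recursion along the algorithm. Independence of the
    past is expressed on [Om] itself, equipped with the smaller sigma-algebra generated by the
    earlier samples. *)

(** * Euclidean inner product and norm *)

Section dotv_theory.
Context {R : realType} {k : nat}.
Implicit Types u v w : 'rV[R]_k.

Lemma dotvC u v : dotv u v = dotv v u.
Proof. by apply: eq_bigr => i _; rewrite mulrC. Qed.

Lemma dotvDl u v w : dotv (u + v) w = dotv u w + dotv v w.
Proof. by rewrite -big_split; apply: eq_bigr => i _; rewrite mxE mulrDl. Qed.

Lemma dotvDr u v w : dotv w (u + v) = dotv w u + dotv w v.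
Proof. by rewrite dotvC dotvDl !(dotvC w). Qed.

Lemma dotvZl a u v : dotv (a *: u) v = a * dotv u v.
Proof. by rewrite mulr_sumr; apply: eq_bigr => i _; rewrite mxE mulrA. Qed.

Lemma dotvZr a u v : dotv u (a *: v) = a * dotv u v.
Proof. by rewrite dotvC dotvZl dotvC. Qed.

Lemma dotvNl u v : dotv (- u) v = - dotv u v.
Proof. by rewrite -scaleN1r dotvZl mulN1r. Qed.

Lemma dotvNr u v : dotv u (- v) = - dotv u v.
Proof. by rewrite dotvC dotvNl dotvC. Qed.

Lemma dotv0l v : dotv 0 v = 0.
Proof. by rewrite -(scale0r 0) dotvZl mul0r. Qed.

Lemma dotv0r v : dotv v 0 = 0.
Proof. by rewrite dotvC dotv0l. Qed.

Definition dotvE := (dotvDl, dotvDr, dotvNl, dotvNr, dotvZl, dotvZr).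

Lemma dotv_ge0 u : 0 <= dotv u u.
Proof. by apply: sumr_ge0 => i _; rewrite -expr2 sqr_ge0. Qed.

Lemma norm2_ge0 u : 0 <= norm2 u.
Proof. exact: sqrtr_ge0. Qed.

Lemma norm2_sqr u : norm2 u ^+ 2 = dotv u u.
Proof. by rewrite sqr_sqrtr// dotv_ge0. Qed.

(** Expand the square of [a *: u - v]. The weight [a] stays free: it is tuned for Cauchy-Schwarz and
    again for the smoothness of the conjugate. *)
Lemma dotv_young (a : R) u v : 0 < a ->
  dotv u v <= a / 2 * dotv u u + (2 * a)^-1 * dotv v v.
Proof.
move=> a0; have := dotv_ge0 (a *: u - v); rewrite !dotvE (dotvC v u) => H.
rewrite -(@ler_pM2l _ (2 * a)) ?mulr_gt0// mulrDr mulrA mulVKf; last first.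
  by rewrite mulf_neq0// gt_eqF.
nra.
Qed.

Lemma dotv_cauchy u v : dotv u v <= norm2 u * norm2 v.
Proof.
have [|u0] := ltP 0 (norm2 u); last first.
  have -> : u = 0.
    apply/rowP => i; rewrite mxE; apply/eqP; rewrite -sqrf_eq0.
    have : dotv u u = 0.
      rewrite -norm2_sqr; have -> : norm2 u = 0 by apply: le_anti; rewrite u0 norm2_ge0.
      by rewrite expr0n.
    move=> /eqP; rewrite psumr_eq0; last by move=> j _; rewrite -expr2 sqr_ge0.
    by move=> /allP/(_ i (mem_index_enum _))/implyP/(_ isT); rewrite -expr2.
  by rewrite dotv0l mulr_ge0// norm2_ge0.
move=> u0.
have [v0|v0] := ltP 0 (norm2 v); last first.
  have n0 : norm2 v = 0 by apply: le_anti; rewrite v0 norm2_ge0.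
  rewrite n0 mulr0 leNgt; apply/negP => H.
  (* With [v] of norm 0 this weight yields [dotv u v <= dotv u v / 2], against positivity. *)
  have := @dotv_young (dotv u v / norm2 u ^+ 2) u v.
  rewrite divr_gt0// ?exprn_gt0// => /(_ isT).
  rewrite -!norm2_sqr n0 expr0n mulr0 addr0 [_ / 2 * _]mulrAC divfK ?gt_eqF ?exprn_gt0//.
  lra.
have := @dotv_young (norm2 v / norm2 u) u v (divr_gt0 v0 u0).
rewrite -!norm2_sqr => /le_trans; apply.
rewrite le_eqVlt; apply/orP; left; apply/eqP; field.
by rewrite !gt_eqF.
Qed.

Lemma norm2N u : norm2 (- u) = norm2 u.
Proof. by rewrite /norm2 dotvNl dotvNr opprK. Qed.

Lemma norm2_triangle u v : norm2 (u + v) <= norm2 u + norm2 v.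
Proof.
rewrite -(@ler_pXn2r _ 2) ?nnegrE ?addr_ge0 ?norm2_ge0//.
rewrite norm2_sqr !dotvE sqrrD !norm2_sqr (dotvC v u).
have := dotv_cauchy u v; lra.
Qed.

Lemma dotv_norm_le u v : `|dotv u v| <= norm2 u * norm2 v.
Proof.
by rewrite ler_norml dotv_cauchy andbT lerNl -dotvNl -(norm2N u) dotv_cauchy.
Qed.

Lemma coord_le_norm2 u j : `|u 0 j| <= norm2 u.
Proof.
rewrite -(@ler_pXn2r _ 2) ?nnegrE ?norm2_ge0//.
rewrite norm2_sqr /dotv (bigD1 j)//= real_normK ?num_real// expr2 lerDl.
by apply: sumr_ge0 => i _; rewrite -expr2 sqr_ge0.
Qed.

End dotv_theory.

(** * Smoothness of the Fenchel conjugate and its Bregman divergence *)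

Section conjugate.
Context {R : realType} {k : nat} (Dom : set 'rV[R]_k) (h : 'rV[R]_k -> R).
Hypothesis Dom0 : Dom !=set0.
Hypothesis Dconv : convex_setv Dom.
Hypothesis Hfin : forall v, has_ubound [set dotv v u - h u | u in Dom].
Hypothesis Hdiff : forall v, differentiable (fconj Dom h) v.
Context (beta : R).
Hypothesis beta0 : 0 < beta.
Hypothesis Hsc : strongly_convex_on Dom h beta^-1.
Local Notation F := (fconj Dom h).
Local Notation gF := (grad F).

Lemma fconj_ge v u : Dom u -> dotv v u - h u <= F v.
Proof. by move=> Du; apply: ub_le_sup => //; exists u. Qed.

Lemma fconj_le v a : (forall u, Dom u -> dotv v u - h u <= a) -> F v <= a.
Proof.
move=> H; apply: ge_sup; first by case: Dom0 => u Du; exists (dotv v u - h u), u.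
by move=> _ [u Du <-]; exact: H.
Qed.

(** [Dom] need not be closed nor [h] semicontinuous, so the supremum may have no maximizer;
    near-maximizers replace it. *)
Lemma fconj_approx v (e : R) : 0 < e ->
  exists2 u, Dom u & F v - e < dotv v u - h u.
Proof.
move=> e0; have [|_ [u Du <-] H] := @sup_adherent _ [set dotv v u - h u | u in Dom] _ e0.
  by split => //; case: Dom0 => u Du; exists (dotv v u - h u), u.
by exists u.
Qed.

Lemma deriveE_grad (f : 'rV[R]_k -> R) v w : differentiable f v ->
  'D_w f v = dotv (grad f v) w.
Proof.
move=> df; rewrite deriveE// [in LHS](row_sum_delta w) linear_sum.
by apply: eq_bigr => i _; rewrite linearZ/= mxE deriveE// mulrC.
Qed.

Lemma grad_cvg (f : 'rV[R]_k -> R) v w : differentiable f v ->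
  s^-1 * (f (v + s *: w) - f v) @[s --> (0:R)^'] --> dotv (grad f v) w.
Proof.
move=> df; rewrite -deriveE_grad//.
have H : derivable f v w by exact: diff_derivable.
have -> : (fun s : R => s^-1 * (f (v + s *: w) - f v)) =
  (fun s : R => s^-1 *: (f (s *: w + v) - f v)).
  by apply/funext => s; rewrite [v + _]addrC.
exact: H.
Qed.

Lemma fconj_convex v w t : 0 <= t <= 1 -> F (v + t *: w) <= (1 - t) * F v + t * F (v + w).
Proof.
move=> /andP[t0 t1]; apply: fconj_le => u Du.
have H1 := fconj_ge v Du; have H2 := fconj_ge (v + w) Du.
move: H2; rewrite !dotvE => H2; nra.
Qed.

Lemma grad_approx (f : 'rV[R]_k -> R) v w (e : R) : differentiable f v -> 0 < e ->
  exists s : R, [/\ 0 < s, s <= 1 &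
    `|dotv (grad f v) w - s^-1 * (f (v + s *: w) - f v)| < e].
Proof.
move=> df e0.
have /cvg_dnbhs_at_right/cvgrPdist_lt/(_ _ e0) H := @grad_cvg f v w df.
near (0 : R)^'+ => s; exists s; split; near: s.
- exact: nbhs_right_gt.
- exact: nbhs_right_le.
- exact: H.
Unshelve. all: by end_near. Qed.

(** By convexity the difference quotient at any [s] in (0, 1] is at most [F (v + w) - F v], and a
    small [s] brings it near the derivative. *)
Lemma fconj_grad_ge v w : F v + dotv (gF v) w <= F (v + w).
Proof.
apply/ler_addgt0Pl => e e0.
have [s [s0 s1]] := @grad_approx F v w e (Hdiff v) e0.
rewrite ltr_distlC => /andP[H _].
have : F (v + s *: w) <= (1 - s) * F v + s * F (v + w).
  by apply: fconj_convex; rewrite ltW.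
have : s^-1 * (F (v + s *: w) - F v) * s = F (v + s *: w) - F v.
  by rewrite mulrAC mulVf ?gt_eqF// mul1r.
move: H; set Q := s^-1 * _ => H E C.
have : Q <= F (v + w) - F v by rewrite -(ler_pM2r s0) E; lra.
lra.
Qed.

(** Duality between strong convexity and smoothness, run on a near-maximizer [u] at [v]. Four errors
    of size [d = e / 4] accumulate: two in [wu], one in [H1], one from the choice of [t]. *)
Lemma fconj_grad_le v w :
  F (v + w) <= F v + dotv (gF v) w + beta / 2 * dotv w w.
Proof.
apply/ler_addgt0Pl => e e0; set d := e / 4; have d0 : 0 < d by rewrite divr_gt0.
have [s [s0 s1]] := @grad_approx F v w d (Hdiff v) d0.
rewrite ltr_distlC => /andP[_ H].
have [t [t0 t1 tw]] : exists t : R, [/\ 0 < t, t <= 2^-1 & beta * t * dotv w w <= d].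
  have ww : 0 <= beta * dotv w w by rewrite mulr_ge0// ?dotv_ge0// ltW.
  exists (Num.min 2^-1 (d / (1 + beta * dotv w w))).
  rewrite lt_min invr_gt0 ltr0n divr_gt0 ?ltr_wpDr//; split => //.
    by rewrite ge_min lexx.
  rewrite mulrAC; apply: (@le_trans _ _ (beta * dotv w w * (d / (1 + beta * dotv w w)))).
    by rewrite ler_wpM2l// ge_min lexx orbT.
  rewrite mulrCA ler_piMr ?(ltW d0)// ler_pdivrMr ?ltr_wpDr// mul1r; lra.
(* The gap of [u] is later divided by [s] in [wu] and by [t] in [H1], hence this tolerance. *)
have m0 : 0 < Num.min (s * d) (t * d) by rewrite lt_min !mulr_gt0.
have [u Du Hu] := fconj_approx v m0.
have {}Hu : F v - s * d < dotv v u - h u /\ F v - t * d < dotv v u - h u.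
  split; (apply: le_lt_trans Hu; rewrite lerD2l lerN2 ge_min lexx ?orbT//).
case: Hu => Hu1 Hu2.
(* [u] is also a candidate in the supremum at [v + s *: w], so the difference quotient of [F] nearly
   dominates [dotv w u]. *)
have wu : dotv w u <= dotv (gF v) w + d + d.
  have := fconj_ge (v + s *: w) Du; rewrite !dotvE => H3.
  have : s^-1 * (F (v + s *: w) - F v) * s = F (v + s *: w) - F v.
    by rewrite mulrAC mulVf ?gt_eqF// mul1r.
  nra.
apply: fconj_le => x Dx.
set q := dotv (x - u) (x - u).
have q0 : 0 <= q by exact: dotv_ge0.
have t01 : 0 <= t <= 1 by lra.
(* Test [F v] on the point of the segment from [u] to [x] with weight [t] on [x], then divide by
   [t]: strong convexity penalizes the distance of [x] from [u]. *)
have H1 : dotv v x - h x <= F v + d - (1 - t) * (q / beta / 2).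
  have := fconj_ge v (Dconv Dx Du t01); have := Hsc Dx Du t01.
  rewrite norm2_sqr -/q !dotvE.
  set hh := h (_ + _) => A B.
  have C : t * (dotv v x - h x) <= t * (F v + d - (1 - t) * (q / beta / 2)); last first.
    by rewrite -(ler_pM2l t0).
  have -> : q / beta / 2 = beta^-1 / 2 * q by ring.
  nra.
(* The Young weight [beta / (1 - t)] reproduces the penalty of [H1] exactly; the remaining
   coefficient is handled by [1 <= (1 - t) (1 + 2 t)], valid for [t <= 1/2]. *)
have H2 : dotv w (x - u) <= (1 - t) * (q / beta / 2) + beta / 2 * dotv w w + beta * t * dotv w w.
  have b1 : 0 < beta / (1 - t) by rewrite divr_gt0//; lra.
  have := @dotv_young _ _ _ w (x - u) b1; rewrite -/q => /le_trans; apply.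
  have -> : (2 * (beta / (1 - t)))^-1 * q = (1 - t) * (q / beta / 2).
    field; apply/andP; split; rewrite ?gt_eqF//; lra.
  rewrite addrC -addrA lerD2l -mulrDl ler_wpM2r ?dotv_ge0//.
  have -> : beta / 2 + beta * t = beta * (2^-1 + t) by ring.
  rewrite -!mulrA ler_wpM2l ?(ltW beta0)//.
  rewrite -(@ler_pM2l _ (1 - t)); last lra.
  by rewrite mulrA mulfV; [nra|rewrite gt_eqF//; lra].
move: H2; rewrite !dotvE => H2.
have : d * 4 = e by rewrite /d divfK.
lra.
Qed.

Definition bregman v w := F v - F w - dotv (gF w) (v - w).

Lemma bregman_ge0 v w : 0 <= bregman v w.
Proof.
by have := fconj_grad_ge w (v - w); rewrite [w + _]addrC subrK /bregman; lra.
Qed.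

Lemma bregman_le v w : bregman v w <= beta / 2 * dotv (v - w) (v - w).
Proof.
by have := fconj_grad_le w (v - w); rewrite [w + _]addrC subrK /bregman; lra.
Qed.

(** Evaluate [F] at [v - q / beta], a gradient step from [v] on [F] minus its tangent at [w]. The
    tangent at [w] bounds this value below, smoothness at [v] bounds it above. *)
Lemma bregman_ge_grad v w :
  dotv (gF v - gF w) (gF v - gF w) <= 2 * beta * bregman v w.
Proof.
set q := gF v - gF w.
have H1 := fconj_grad_le v (- beta^-1 *: q).
have := fconj_grad_ge w (v - w - beta^-1 *: q).
have -> : w + (v - w - beta^-1 *: q) = v + (- beta^-1) *: q.
  by rewrite addrA [w + _]addrC subrK scaleNr.
move=> H2; have := le_trans H2 H1.
have : gF v = q + gF w by rewrite subrK.
rewrite /bregman; move: (F v) (F w) (gF v) (gF w) q {H1 H2} => fv fw gv gw q ->.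
rewrite !dotvE => H.
have bN : beta^-1 * beta = 1 by rewrite mulVf ?gt_eqF.
have E : beta / 2 * (- beta^-1 * (- beta^-1 * dotv q q)) = beta^-1 / 2 * dotv q q.
  by field; rewrite gt_eqF.
rewrite E in H.
have {}H : beta^-1 / 2 * dotv q q <= fv - fw - (dotv gw v - dotv gw w) by lra.
rewrite -(@ler_pM2l _ (beta^-1 / 2)) ?divr_gt0// ?invr_gt0//.
apply: le_trans H _.
rewrite le_eqVlt; apply/orP; left; apply/eqP; field; by rewrite gt_eqF.
Qed.

Lemma grad_fconj_lipschitz v w : norm2 (gF v - gF w) <= beta * norm2 (v - w).
Proof.
rewrite -(@ler_pXn2r _ 2) ?nnegrE ?mulr_ge0 ?norm2_ge0// ?(ltW beta0)//.
rewrite exprMn !norm2_sqr; apply: le_trans (bregman_ge_grad v w) _.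
apply: le_trans (ler_wpM2l _ (bregman_le v w)) _; first by rewrite mulr_ge0// ltW.
rewrite le_eqVlt; apply/orP; left; apply/eqP; by field.
Qed.

Lemma bregman_sym v w :
  bregman v w + bregman w v = dotv (gF v - gF w) (v - w).
Proof.
by rewrite /bregman; move: (gF v) (gF w) => gv gw; rewrite !dotvE; ring.
Qed.

Lemma dotv_sumr (I : finType) (f : I -> 'rV[R]_k) v :
  dotv v (\sum_i f i) = \sum_i dotv v (f i).
Proof.
by apply: (big_morph (dotv v)) => [x y|]; rewrite ?dotvDr ?dotv0r.
Qed.

(** Jensen's inequality: sum the tangent inequalities at the mean [m], whose linear terms cancel.
    The rest of the divergence is affine in its first argument and averages exactly. *)
Lemma bregman_avg n (f : 'I_n -> 'rV[R]_k) w : (0 < n)%N ->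
  bregman (n%:R^-1 *: \sum_i f i) w <= n%:R^-1 * \sum_i bregman (f i) w.
Proof.
move=> n0; set m := _ *: _; have n0' : (0 : R) < n%:R by rewrite ltr0n.
have mE : \sum_i f i = n%:R *: m by rewrite /m scalerA mulfV ?gt_eqF// scale1r.
rewrite -(@ler_pM2l _ n%:R)// mulrA mulfV ?gt_eqF// mul1r.
have : \sum_i (F m + dotv (gF m) (f i - m)) <= \sum_i F (f i).
  by apply: ler_sum => i _; have := fconj_grad_ge m (f i - m); rewrite [m + _]addrC subrK.
rewrite big_split/= sumr_const card_ord -dotv_sumr big_split/= sumr_const card_ord mE.
rewrite mulNrn -[m *+ n]scaler_nat subrr dotv0r addr0 -mulr_natl => H.
have wE : \sum_i (f i - w) = n%:R *: (m - w).
  by rewrite big_split/= mE sumr_const card_ord mulNrn -[w *+ n]scaler_nat -scalerBr.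
have -> : \sum_i bregman (f i) w =
    \sum_i F (f i) - n%:R * F w - n%:R * dotv (gF w) (m - w).
  rewrite -dotvZr -wE dotv_sumr -!sumrN -[n in n%:R * _]card_ord mulr_natl -sumr_const.
  by rewrite -sumrN -!big_split.
rewrite /bregman; move: H; move: (F m) (F w) (dotv _ _) (\sum_i F _) => a b d S H; lra.
Qed.

End conjugate.

(** * The vector-valued RKHS and the projection onto its ball *)

Section rkhs.
Context {R : realType} {X : Type} {k : nat}.
Context (Hs : set (X -> R)) (ip : (X -> R) -> (X -> R) -> R) (kk : X -> X -> R).
Hypothesis Hrkhs : is_rkhs Hs ip kk.
Implicit Types f g h : X -> 'rV[R]_k.

Definition ipG f g : R := \sum_(j < k) ip (fun x => f x 0 j) (fun x => g x 0 j).

(** The tensor of [a] with the kernel section at [x]; it represents the functional sending [f] to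
    [dotv (f x) a]. *)
Definition kerG (x : X) (a : 'rV[R]_k) : X -> 'rV[R]_k := fun z => kk x z *: a.

Lemma inG_linear a f g : inG Hs f -> inG Hs g -> inG Hs (fun x => a *: f x + g x).
Proof.
case: Hrkhs => [[_ HD HZ _] _] Hf Hg j.
have -> : (fun x => (a *: f x + g x) 0 j) = (fun x => a * f x 0 j + g x 0 j).
  by apply/funext => x; rewrite !mxE.
exact: (HD (fun x => a * f x 0 j) _ (HZ _ _ (Hf j)) (Hg j)).
Qed.

Lemma inG0 : inG Hs (fun=> 0 : 'rV[R]_k).
Proof.
case: Hrkhs => [[H0 _ _ _] _] j.
by have -> : (fun x : X => (0 : 'rV[R]_k) 0 j) = (fun=> 0) by apply/funext => x; rewrite mxE.
Qed.

Lemma inGZ a f : inG Hs f -> inG Hs (fun x => a *: f x).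
Proof.
case: Hrkhs => [[_ _ HZ _] _] Hf j.
have -> : (fun x => (a *: f x) 0 j) = (fun x => a * f x 0 j).
  by apply/funext => x; rewrite !mxE.
exact: HZ.
Qed.

Lemma inGB f g : inG Hs f -> inG Hs g -> inG Hs (fun x => f x - g x).
Proof.
move=> Hf Hg; have -> : (fun x => f x - g x) = (fun x => -1 *: g x + f x).
  by apply/funext => x; rewrite scaleN1r addrC.
exact: inG_linear.
Qed.

Lemma inG_ker x a : inG Hs (kerG x a).
Proof.
case: Hrkhs => [[_ _ HZ Hk] _] j.
have -> : (fun z => kerG x a z 0 j) = (fun z => a 0 j * kk x z).
  by apply/funext => z; rewrite !mxE mulrC.
exact/HZ/Hk.
Qed.

Lemma ipGC f g : inG Hs f -> inG Hs g -> ipG f g = ipG g f.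
Proof.
by case: Hrkhs => [_ [H _ _ _ _]] Hf Hg; apply: eq_bigr => j _; exact: H.
Qed.

Lemma ipG_linear a f g h : inG Hs f -> inG Hs g -> inG Hs h ->
  ipG (fun x => a *: f x + g x) h = a * ipG f h + ipG g h.
Proof.
case: Hrkhs => [_ [_ H _ _ _]] Hf Hg Hh.
rewrite /ipG mulr_sumr -big_split; apply: eq_bigr => j _ /=.
rewrite -H//; congr ip; by apply/funext => x; rewrite !mxE.
Qed.

Lemma ipG_ge0 f : inG Hs f -> 0 <= ipG f f.
Proof.
by case: Hrkhs => [_ [_ _ H _ _]] Hf; apply: sumr_ge0 => j _; case: (H _ (Hf j)).
Qed.

Lemma ipG_ker f x a : inG Hs f -> ipG f (kerG x a) = dotv (f x) a.
Proof.
case: Hrkhs => [[H0 _ HZ Hk] [HC HL _ H _]] Hf; apply: eq_bigr => j _.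
(* Linearity of [ip] is given only for the shape [a * f + g], hence the added zero function. *)
have -> : (fun z => kerG x a z 0 j) = (fun z => a 0 j * kk x z + 0).
  by apply/funext => z; rewrite !mxE mulrC addr0.
have Hka : Hs (fun z => a 0 j * kk x z + 0).
  have -> : (fun z => a 0 j * kk x z + 0) = (fun z => a 0 j * kk x z).
    by apply/funext => z; rewrite addr0.
  exact: HZ.
rewrite HC// (HL _ _ (fun=> 0))// HC// H//.
have -> : ip (fun=> 0) (fun x0 => f x0 0 j) = 0.
  have := HL 1 _ _ _ H0 H0 (Hf j).
  have -> : (fun x0 : X => 1 * 0 + 0) = (fun=> 0 : R).
    by apply/funext => z; rewrite mulr0 addr0.
  by rewrite mul1r => /eqP; rewrite -subr_eq0 opprD addNKr oppr_eq0 => /eqP.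
by rewrite addr0 mulrC.
Qed.

Lemma ipG_sqr_linear a f g : inG Hs f -> inG Hs g ->
  ipG (fun x => a *: f x + g x) (fun x => a *: f x + g x) =
  a ^+ 2 * ipG f f + 2 * a * ipG f g + ipG g g.
Proof.
move=> Hf Hg; have Hfg := inG_linear a Hf Hg.
rewrite ipG_linear// (ipGC Hf Hfg) (ipGC Hg Hfg) !ipG_linear// (ipGC Hg Hf).
ring.
Qed.

Lemma ipG_sqrZ a f : inG Hs f ->
  ipG (fun x => a *: f x) (fun x => a *: f x) = a ^+ 2 * ipG f f.
Proof.
move=> Hf; have := ipG_sqr_linear (a - 1) Hf Hf.
have -> : (fun x => (a - 1) *: f x + f x) = (fun x => a *: f x).
  by apply/funext => x; rewrite scalerBl scale1r subrK.
by move=> ->; ring.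
Qed.

Lemma ipG_sqrB f g : inG Hs f -> inG Hs g ->
  ipG (fun x => f x - g x) (fun x => f x - g x) =
  ipG f f - 2 * ipG f g + ipG g g.
Proof.
move=> Hf Hg; have := ipG_sqr_linear (-1) Hg Hf.
have -> : (fun x => -1 *: g x + f x) = (fun x => f x - g x).
  by apply/funext => x; rewrite scaleN1r addrC.
by move=> ->; rewrite (ipGC Hg Hf); ring.
Qed.

Lemma normG_sqr g : inG Hs g -> normG ip g ^+ 2 = ipG g g.
Proof. by move=> Hg; rewrite sqr_sqrtr// ipG_ge0. Qed.

Context (kappa : R).
Hypothesis kappa0 : 0 < kappa.
Hypothesis kk_le : forall x, kk x x <= kappa ^+ 2.

Lemma kerG_self x a : ipG (kerG x a) (kerG x a) = kk x x * dotv a a.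
Proof. by rewrite ipG_ker ?dotvZl//; exact: inG_ker. Qed.

(** Nonnegativity of the squared norm of [g] minus [kappa ^- 2] times the kernel element
    [kerG x (g x)], expanded with the reproducing property. *)
Lemma eval_le g x : inG Hs g -> dotv (g x) (g x) <= kappa ^+ 2 * ipG g g.
Proof.
move=> Hg; set q := dotv _ _.
have q0 : 0 <= q by exact: dotv_ge0.
have k20 : 0 < kappa ^+ 2 by rewrite exprn_gt0.
have := ipG_ge0 (inG_linear (- kappa ^- 2) (inG_ker x (g x)) Hg).
rewrite ipG_sqr_linear//; last exact: inG_ker.
rewrite kerG_self (ipGC (inG_ker _ _) Hg) ipG_ker// -/q => H.
have E : kappa ^- 2 * kappa ^+ 2 = 1 by rewrite mulVf// gt_eqF.
rewrite -(@ler_pM2l _ (kappa ^- 2)) ?invr_gt0// mulrA E mul1r.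
have : (- kappa ^- 2) ^+ 2 * (kk x x * q) <= kappa ^- 2 * q.
  rewrite sqrrN expr2 mulrA -[X in X <= _]mulrA -mulrA ler_wpM2l ?invr_ge0 ?(ltW k20)//.
  rewrite mulrA -[X in _ <= X]mul1r ler_wpM2r// -E ler_wpM2l ?invr_ge0 ?(ltW k20)//.
lra.
Qed.

Context (D : R).
Hypothesis D0 : 0 < D.

Lemma projG_in g : inG Hs g -> inG Hs (projG ip D g).
Proof. by rewrite /projG; case: ifP => // _ Hg; exact: inGZ. Qed.

Lemma normG_le_sqr g : inG Hs g -> (normG ip g <= D) = (ipG g g <= D ^+ 2).
Proof.
by move=> Hg; rewrite -normG_sqr// ler_pXn2r// nnegrE ?sqrtr_ge0// ltW.
Qed.

Lemma projG_le g : inG Hs g -> ipG (projG ip D g) (projG ip D g) <= D ^+ 2.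
Proof.
move=> Hg; rewrite /projG; case: ifPn => [|/negbTE]; rewrite normG_le_sqr// => H.
rewrite ipG_sqrZ// -normG_sqr// -exprMn divfK//.
apply: contraFN H => /eqP N0; rewrite -normG_sqr// N0 expr0n/= sqr_ge0//.
Qed.

(** Outside the ball the projection is radial, and the claim reduces to
    [2 (1 - D/N) <g, gs> <= N^2 - D^2]. It follows from [<g, gs> <= N D] and [(N - D)^2 >= 0]. *)
Lemma projG_dist g gs : inG Hs g -> inG Hs gs -> ipG gs gs <= D ^+ 2 ->
  ipG (fun x => projG ip D g x - gs x) (fun x => projG ip D g x - gs x) <=
  ipG (fun x => g x - gs x) (fun x => g x - gs x).
Proof.
move=> Hg Hgs gsD; rewrite /projG; case: ifPn => //; rewrite -ltNge => ND.
set N := normG ip g in ND *.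
have N0 : 0 < N by exact: lt_trans ND.
have lin := ipG_sqr_linear (D / N) Hg (inGZ (-1) Hgs).
have -> : (fun x => D / N *: g x - gs x) = (fun x => D / N *: g x + -1 *: gs x).
  by apply/funext => x; rewrite scaleN1r.
rewrite lin ipG_sqrZ// ipG_sqrB// -normG_sqr// -/N.
have -> : ipG g (fun x => -1 *: gs x) = - ipG g gs.
  have := ipG_linear (-1) Hgs (@inG0) Hg.
  have -> : (fun x => -1 *: gs x + 0) = (fun x => -1 *: gs x).
    by apply/funext => x; rewrite addr0.
  rewrite ipGC//; last exact: inGZ.
  move=> ->; have -> : ipG (fun=> 0) g = 0.
    have := ipG_linear (-1) Hg Hg Hg.
    have -> : (fun x => -1 *: g x + g x) = (fun=> 0).
      by apply/funext => x; rewrite scaleN1r addNr.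
    by move=> ->; rewrite mulN1r addNr.
  by rewrite mulN1r addr0 ipGC.
(* Cauchy-Schwarz through the squared norm of [D g - N gs]. *)
have CS : ipG g gs <= N * D.
  have := ipG_ge0 (inG_linear (- N) Hgs (inGZ D Hg)).
  rewrite ipG_sqr_linear//; last exact: inGZ.
  rewrite ipG_sqrZ// -[ipG g g]normG_sqr// -/N.
  have -> : ipG gs (fun x => D *: g x) = D * ipG g gs.
    have := ipG_linear (D - 1) Hg Hg Hgs.
    have -> : (fun x => (D - 1) *: g x + g x) = (fun x => D *: g x).
      by apply/funext => x; rewrite scalerBl scale1r subrK.
    rewrite ipGC//; last exact: inGZ.
    by move=> ->; ring.
  move=> H.
  rewrite -(@ler_pM2l _ (2 * N * D)) ?mulr_gt0//.
  have : N ^+ 2 * ipG gs gs <= N ^+ 2 * D ^+ 2 by rewrite ler_wpM2l// sqr_ge0.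
  rewrite sqrrN in H; lra.
have E : (D / N) ^+ 2 * N ^+ 2 = D ^+ 2 by rewrite -exprMn divfK// gt_eqF.
rewrite E sqrrN expr1n mul1r lerD2r.
have l1 : D / N <= 1 by rewrite ler_pdivrMr// mul1r ltW.
have l2 : D / N * (N * D) = D ^+ 2 by field; rewrite gt_eqF.
have : (1 - D / N) * ipG g gs <= (1 - D / N) * (N * D) by rewrite ler_wpM2l// subr_ge0.
have := sqr_ge0 (N - D).
move: (D / N) (ipG g gs) l2 CS => l a l2 CS.
nra.
Qed.

End rkhs.

(** * Deterministic analysis of one sample path *)

Section asgd_path.
Context {R : realType} {X Y : Type} {k : nat}.
Context (Hs : set (X -> R)) (ip : (X -> R) -> (X -> R) -> R) (kk : X -> X -> R).
Hypothesis Hrkhs : is_rkhs Hs ip kk.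
Context (kappa D eta : R).
Hypothesis kappa0 : 0 < kappa.
Hypothesis kk_le : forall x, kk x x <= kappa ^+ 2.
Hypothesis D0 : 0 < D.
Context (gradS : 'rV[R]_k -> Y -> 'rV[R]_k).
Local Notation iter := (asgd_iter ip kk D eta gradS).

Lemma asgd_step_kerG (g : X -> 'rV[R]_k) (p : X * Y) :
  (fun x => g x - (eta * kk p.1 x) *: gradS (g p.1) p.2) =
  (fun x => - eta *: kerG kk p.1 (gradS (g p.1) p.2) x + g x).
Proof. by apply/funext => x; rewrite addrC scaleNr scalerA. Qed.

Lemma asgd_step_in (g : X -> 'rV[R]_k) (p : X * Y) : inG Hs g ->
  inG Hs (fun x => g x - (eta * kk p.1 x) *: gradS (g p.1) p.2).
Proof.
by move=> Hg; rewrite asgd_step_kerG; apply: (inG_linear Hrkhs) => //; exact: (inG_ker Hrkhs).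
Qed.

(** Serves measurability: the norm of the step, defined through the abstract [ip], is expressed by
    kernel values, evaluations and the previous norm. *)
Lemma asgd_step_sqr (g : X -> 'rV[R]_k) (p : X * Y) : inG Hs g ->
  let q := gradS (g p.1) p.2 in
  let g' := fun x => g x - (eta * kk p.1 x) *: q in
  ipG ip g' g' = eta ^+ 2 * (kk p.1 p.1 * dotv q q) - 2 * eta * dotv q (g p.1) + ipG ip g g.
Proof.
move=> Hg q g'; rewrite /g' asgd_step_kerG (ipG_sqr_linear Hrkhs)//; last exact: (inG_ker Hrkhs).
rewrite (kerG_self Hrkhs) (ipGC Hrkhs (inG_ker Hrkhs _ _) Hg) (ipG_ker Hrkhs)// sqrrN.
by rewrite (dotvC (g _)) -/q; ring.
Qed.

Lemma asgd_iter_in s i : inG Hs (iter s i).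
Proof.
elim: i => [|i IH]; first exact: (inG0 Hrkhs).
by apply: (projG_in Hrkhs); exact: asgd_step_in.
Qed.

Lemma asgd_iter_sqr_le s i : ipG ip (iter s i) (iter s i) <= D ^+ 2.
Proof.
case: i => [|i]; last by apply: (projG_le Hrkhs D0); exact/asgd_step_in/asgd_iter_in.
have -> : ipG ip (iter s 0) (iter s 0) = 0; last by rewrite sqr_ge0.
have H0 := @asgd_iter_in s 0; have := ipG_linear Hrkhs (-1) H0 H0 H0 => /=.
have -> : (fun x : X => -1 *: (0 : 'rV[R]_k) + 0) = (fun=> 0).
  by apply/funext => x; rewrite scaler0 addr0.
by move=> ->; rewrite mulN1r addNr.
Qed.

Lemma asgd_iter_eval_le s i x : dotv (iter s i x) (iter s i x) <= (kappa * D) ^+ 2.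
Proof.
apply: le_trans (eval_le Hrkhs kappa0 kk_le x (asgd_iter_in s i)) _.
by rewrite exprMn ler_wpM2l ?sqr_ge0// asgd_iter_sqr_le.
Qed.

Context (gs : X -> 'rV[R]_k).
Hypothesis gs_in : inG Hs gs.
Hypothesis gs_le : ipG ip gs gs <= D ^+ 2.

Definition asgd_dist s i :=
  ipG ip (fun x => iter s i x - gs x) (fun x => iter s i x - gs x).

(** The step moves along a kernel section, so the reproducing property turns the cross term into a
    pointwise pairing at the fresh sample. *)
Lemma asgd_dist_step s i q : q = gradS (iter s i (s i).1) (s i).2 ->
  asgd_dist s i.+1 <= asgd_dist s i
    - 2 * eta * dotv q (iter s i (s i).1 - gs (s i).1)
    + eta ^+ 2 * (kk (s i).1 (s i).1 * dotv q q).
Proof.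
move=> qE; have Hi := asgd_iter_in s i.
rewrite /asgd_dist /= -qE.
have Hi' := asgd_step_in (s i) Hi; rewrite -qE in Hi'.
apply: le_trans (projG_dist Hrkhs D0 Hi' gs_in gs_le) _.
have -> : (fun x => iter s i x - (eta * kk (s i).1 x) *: q - gs x) =
  (fun x => - eta *: kerG kk (s i).1 q x + (iter s i x - gs x)).
  by apply/funext => x; rewrite scaleNr scalerA addrAC addrC.
have Hd := inGB Hrkhs Hi gs_in.
have Hq := inG_ker Hrkhs (s i).1 q.
rewrite (ipG_sqr_linear Hrkhs)// (kerG_self Hrkhs) (ipGC Hrkhs Hq Hd) (ipG_ker Hrkhs)//.
rewrite (dotvC _ q) sqrrN; lra.
Qed.

Lemma asgd_dist0 s : asgd_dist s 0 <= D ^+ 2.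
Proof.
rewrite /asgd_dist /=.
have -> : (fun x => 0 - gs x) = (fun x => -1 *: gs x).
  by apply/funext => x; rewrite scaleN1r sub0r.
by rewrite (ipG_sqrZ Hrkhs)// sqrrN expr1n mul1r.
Qed.

Lemma asgd_eval_dist s i x : dotv (iter s i x - gs x) (iter s i x - gs x) <=
  kappa ^+ 2 * asgd_dist s i.
Proof. by apply: (eval_le Hrkhs kappa0 kk_le); apply: (inGB Hrkhs) => //; exact: asgd_iter_in. Qed.

End asgd_path.

(** * Measurability of vector-valued and finite-valued maps *)

Section measurability.
Context {d : measure_display} {T : measurableType d} {R : realType}.

Lemma measurable_fun_countable {I : countType} (c : T -> I) (f : I -> R) :
  (forall i, measurable (c @^-1` [set i])) -> measurable_fun setT (f \o c).
Proof.
move=> mc _ B mB; rewrite setTI.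
have -> : (f \o c) @^-1` B =
    \bigcup_i (if f i \in B then c @^-1` [set i] else set0).
  apply/seteqP; split => [x Bx|x [i _]].
    by exists (c x) => //; rewrite ifT ?inE.
  by case: ifPn => //; rewrite inE => Bi /= cx; rewrite /preimage /= cx.
apply: countable_bigcupT_measurable => [|i]; first exact: countableP.
by case: ifP.
Qed.

Lemma measurable_fun_floor : measurable_fun setT (fun x : R => (Num.floor x)%:~R : R).
Proof.
by apply: nondecreasing_measurable => // x y xy; rewrite ler_int le_floor.
Qed.

(* [g] is approximated by functions with countably many values *)
Lemma measurable_fun_continuous_vec k (F : 'rV[R]_k -> R) (g : T -> 'rV[R]_k) :
  continuous F -> measurable_vec g -> measurable_fun setT (F \o g).
Proof.
move=> cF mg.
(* Coordinates are rounded down to the grid of mesh [1 / m.+1]; the integer codes form a countable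
   type and have measurable fibres. *)
pose c (m : nat) (x : T) : 'rV[int]_k := \row_j Num.floor (m.+1%:R * g x 0 j).
pose r (m : nat) (z : 'rV[int]_k) : 'rV[R]_k := \row_j ((z 0 j)%:~R / m.+1%:R).
apply: (@measurable_fun_cvg _ _ _ _ (fun m => F \o r m \o c m)) => [m|x _].
  apply: (@measurable_fun_countable _ (c m) (F \o r m)) => z.
  have -> : c m @^-1` [set z] = \bigcap_(j in [set: 'I_k])
      ((fun x => (Num.floor (m.+1%:R * g x 0 j))%:~R : R) @^-1` [set (z 0 j)%:~R]).
    apply/seteqP; split => [x /= <- j _|x H]; first by rewrite /= /c mxE.
    by apply/rowP => j; rewrite mxE; apply/eqP; rewrite -(eqr_int R); apply/eqP; exact: H.
  apply: fin_bigcap_measurable => [|j _]; first exact: finite_finset.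
  rewrite -[X in measurable X]setTI.
  have mfl : measurable_fun setT (fun x => (Num.floor (m.+1%:R * g x 0 j))%:~R : R).
    by apply: (measurableT_comp measurable_fun_floor); exact: measurable_funM.
  by apply: mfl => //; exact: measurable_set1.
apply: (@cvg_comp _ _ _ (fun m => r m (c m x)) F); last exact: cF.
apply/cvg_ballP => e e0; near=> m; split => // i j.
rewrite (ord1 i) /r /c !mxE /ball/=.
have m0 : (0 : R) < m.+1%:R by [].
have /andP[f1 f2] := floor_itv (m.+1%:R * g x 0 j).
rewrite ltr_norml.
have me : 1 < m.+1%:R * e.
  rewrite mulrC -ltr_pdivrMl// mulr1; apply: (@lt_trans _ _ m%:R); last by rewrite ltr_nat.
  near: m; exact: nbhs_infty_gtr.
have E : m.+1%:R * ((Num.floor (m.+1%:R * g x 0 j))%:~R / m.+1%:R) =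
    (Num.floor (m.+1%:R * g x 0 j))%:~R :> R.
  by rewrite mulrCA mulfV ?mulr1// gt_eqF.
rewrite intrD in f2.
apply/andP; split; rewrite -(ltr_pM2l m0) ?mulrN !mulrBr E; lra.
Unshelve. all: by end_near. Qed.

Lemma measurable_dotv k (f g : T -> 'rV[R]_k) : measurable_vec f -> measurable_vec g ->
  measurable_fun setT (fun x => dotv (f x) (g x)).
Proof.
by move=> mf mg; apply: measurable_sum => j; apply: measurable_funM.
Qed.

Lemma measurable_vecD k (f g : T -> 'rV[R]_k) : measurable_vec f -> measurable_vec g ->
  measurable_vec (fun x => f x + g x).
Proof.
move=> mf mg j; under eq_fun do rewrite mxE.
exact: measurable_funD.
Qed.

Lemma measurable_vecZ k (a : T -> R) (f : T -> 'rV[R]_k) :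
  measurable_fun setT a -> measurable_vec f ->
  measurable_vec (fun x => a x *: f x).
Proof.
move=> ma mf j; under eq_fun do rewrite mxE.
exact: measurable_funM.
Qed.

Lemma measurable_vecN k (f : T -> 'rV[R]_k) : measurable_vec f ->
  measurable_vec (fun x => - f x).
Proof.
move=> mf j; under eq_fun do rewrite mxE.
exact: measurableT_comp.
Qed.

Lemma measurable_vecB k (f g : T -> 'rV[R]_k) : measurable_vec f -> measurable_vec g ->
  measurable_vec (fun x => f x - g x).
Proof. by move=> mf mg; apply: measurable_vecD => //; exact: measurable_vecN. Qed.

Lemma measurable_vec_cst k (v : 'rV[R]_k) : measurable_vec (fun _ : T => v).
Proof. by move=> j; exact: measurable_cst. Qed.

Lemma measurable_fin_comp (Z W : Type) (u : T -> Z) (f : Z -> W) :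
  measurable_fin u -> measurable_fin (f \o u).
Proof. by move=> mu A; exact: mu (f @^-1` A). Qed.

Lemma measurable_fin_fun (Z : Type) (u : T -> Z) (f : Z -> R) :
  measurable_fin u -> measurable_fun setT (f \o u).
Proof. by move=> mu _ B mB; rewrite setTI; exact: mu (f @^-1` B). Qed.

Lemma measurable_fin_finType (Z : finType) (u : T -> Z) :
  (forall z, measurable (u @^-1` [set z])) -> measurable_fin u.
Proof.
move=> mu A.
have -> : u @^-1` A = \bigcup_(z in A) (u @^-1` [set z]).
  by apply/seteqP; split => [x ux|x [z Az uz]]; [exists (u x)|rewrite /preimage /= uz].
by apply: fin_bigcup_measurable => //; exact: finite_finset.
Qed.

Lemma measurable_fin_ffun (I : finType) (b : I -> T -> bool) :
  (forall i, measurable [set x | b i x]) ->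
  measurable_fin (fun x => [ffun i => b i x]).
Proof.
move=> mb; apply: measurable_fin_finType => z.
have -> : (fun x => [ffun i => b i x]) @^-1` [set z] =
   \bigcap_(i in [set: I]) (if z i then [set x | b i x] else ~` [set x | b i x]).
  apply/seteqP; split => [x /= <- i _|x H]; first by rewrite ffunE; case: ifPn => // /negP.
  apply/ffunP => i; rewrite ffunE; have := H i Logic.I.
  by case: (z i) => //= /negP/negbTE.
apply: fin_bigcap_measurable => [|i _]; first exact: finite_finset.
by case: ifP => // _; exact: measurableC.
Qed.

(** The minimizer, tie-breaking included, is a function of the finite table of pairwise comparisons,
    and each comparison is a measurable event. *)
Lemma measurable_zdec k (Z : finType) (z0 : Z) (psi : Z -> 'rV[R]_k) (u : T -> 'rV[R]_k) :
  measurable_vec u -> measurable_fin (zdec z0 psi \o u).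
Proof.
move=> mu.
pose b (p : Z * Z) x := dotv (psi p.1) (u x) <= dotv (psi p.2) (u x).
pose f (c : {ffun Z * Z -> bool}) : Z :=
  odflt z0 (pick [pred z | xpredT z && [forall (z' | xpredT z'), c (z, z')]]).
have -> : zdec z0 psi \o u = f \o (fun x => [ffun p => b p x]).
  apply/funext => x /=; rewrite /zdec /f /Order.arg_min /extremum.
  congr odflt; apply: eq_pick => z /=.
  by apply: eq_forallb => z'; rewrite ffunE.
apply: measurable_fin_comp; apply: measurable_fin_ffun => p.
rewrite -[X in measurable X]setTI; apply: measurable_fun_le => //;
  by apply: measurable_dotv => //; exact: measurable_vec_cst.
Qed.

End measurability.

(** * Calculus of bounded measurable functions *)

Section bounded_measurable.
Context {d : measure_display} {T : measurableType d} {R : realType}.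
Implicit Types f g : T -> R.

(** A class stable under sums, products and partial integration, and integrable for every
    probability: integrability conditions become closure properties. *)
Definition bmf f := measurable_fun setT f /\ exists M, forall x, `|f x| <= M.

Lemma bmf_cst a : bmf (fun=> a).
Proof. by split; [exact: measurable_cst|exists `|a|]. Qed.

Lemma bmfD f g : bmf f -> bmf g -> bmf (fun x => f x + g x).
Proof.
move=> [mf [M HM]] [mg [N HN]]; split; first exact: measurable_funD.
by exists (M + N) => x; rewrite (le_trans (ler_normD _ _))// lerD.
Qed.

Lemma bmfM f g : bmf f -> bmf g -> bmf (fun x => f x * g x).
Proof.
move=> [mf [M HM]] [mg [N HN]]; split; first exact: measurable_funM.
by exists (M * N) => x; rewrite normrM ler_pM.
Qed.

Lemma bmfZ a f : bmf f -> bmf (fun x => a * f x).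
Proof. by apply: bmfM; exact: bmf_cst. Qed.

Lemma bmfN f : bmf f -> bmf (fun x => - f x).
Proof.
move=> /(bmfZ (-1)).
by have -> : (fun x => -1 * f x) = (fun x => - f x) by apply/funext => x; rewrite mulN1r.
Qed.

Lemma bmfB f g : bmf f -> bmf g -> bmf (fun x => f x - g x).
Proof. by move=> bf bg; apply: bmfD => //; exact: bmfN. Qed.

Lemma bmf_sum (I : Type) (s : seq I) (f : I -> T -> R) :
  (forall i, bmf (f i)) -> bmf (fun x => \sum_(i <- s) f i x).
Proof.
move=> bf; elim: s => [|i s IH].
  by under eq_fun do rewrite big_nil; exact: bmf_cst.
by under eq_fun do rewrite big_cons; exact: bmfD.
Qed.

Definition bmv k (g : T -> 'rV[R]_k) :=
  measurable_vec g /\ exists M, forall x, norm2 (g x) <= M.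

Lemma bmv_dotv k (f g : T -> 'rV[R]_k) : bmv f -> bmv g ->
  bmf (fun x => dotv (f x) (g x)).
Proof.
move=> [mf [M HM]] [mg [N HN]]; split; first exact: measurable_dotv.
exists (M * N) => x; apply: le_trans (dotv_norm_le _ _) _.
by apply: ler_pM => //; exact: norm2_ge0.
Qed.

Lemma bmvD k (f g : T -> 'rV[R]_k) : bmv f -> bmv g -> bmv (fun x => f x + g x).
Proof.
move=> [mf [M HM]] [mg [N HN]]; split; first exact: measurable_vecD.
by exists (M + N) => x; rewrite (le_trans (norm2_triangle _ _))// lerD.
Qed.

Lemma bmvN k (f : T -> 'rV[R]_k) : bmv f -> bmv (fun x => - f x).
Proof.
move=> [mf [M HM]]; split; first exact: measurable_vecN.
by exists M => x; rewrite norm2N.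
Qed.

Lemma bmvB k (f g : T -> 'rV[R]_k) : bmv f -> bmv g -> bmv (fun x => f x - g x).
Proof. by move=> bf bg; apply: bmvD => //; exact: bmvN. Qed.

Lemma bmvZ k a (f : T -> 'rV[R]_k) : bmv f -> bmv (fun x => a *: f x).
Proof.
move=> [mf [M HM]]; split; first by apply: measurable_vecZ => //; exact: measurable_cst.
exists (`|a| * M) => x.
rewrite /norm2 dotvZl dotvZr mulrA -expr2 sqrtrM ?sqr_ge0// sqrtr_sqr.
by rewrite ler_wpM2l// HM.
Qed.

Lemma bmv_sum k (I : Type) (s : seq I) (f : I -> T -> 'rV[R]_k) :
  (forall i, bmv (f i)) -> bmv (fun x => \sum_(i <- s) f i x).
Proof.
move=> bf; elim: s => [|i s IH]; last first.
  have -> : (fun x => \sum_(j <- i :: s) f j x) =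
      (fun x => f i x + \sum_(j <- s) f j x).
    by apply/funext => x; rewrite big_cons.
  exact: bmvD.
have -> : (fun x => \sum_(i <- [::]) f i x) = (fun=> 0 : 'rV[R]_k).
  by apply/funext => x; rewrite big_nil.
by split; [exact: measurable_vec_cst|exists (norm2 (0 : 'rV[R]_k))].
Qed.

Lemma bmv_fin k (Z : finType) (f : Z -> 'rV[R]_k) (u : T -> Z) :
  measurable_fin u -> bmv (fun x => f (u x)).
Proof.
move=> mu; split.
  by move=> j; exact: (measurable_fin_fun (fun z => f z 0 j) mu).
exists (\sum_z norm2 (f z)) => x.
by rewrite (bigD1 (u x))//= lerDl sumr_ge0// => z _; exact: norm2_ge0.
Qed.

Context (P : probability T R).

Lemma bmf_integrable f : bmf f -> P.-integrable setT (EFin \o f).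
Proof.
move=> [mf [M HM]]; apply: measurable_bounded_integrable => //.
  by apply: le_lt_trans (probability_le1 P measurableT) _; rewrite ltry.
exists M; split; first exact: num_real.
by move=> y My x _; exact: le_trans (HM x) (ltW My).
Qed.

Lemma bmf_EFin f : bmf f -> (\int[P]_x (f x)%:E = (\int[P]_x f x)%R%:E)%E.
Proof.
move=> bf; rewrite /Rintegral fineK//.
by apply: integrable_fin_num => //; exact: bmf_integrable.
Qed.

Lemma bmf_intD f g : bmf f -> bmf g ->
  \int[P]_x (f x + g x) = \int[P]_x f x + \int[P]_x g x.
Proof. by move=> bf bg; rewrite RintegralD//; exact: bmf_integrable. Qed.

Lemma bmf_intB f g : bmf f -> bmf g ->
  \int[P]_x (f x - g x) = \int[P]_x f x - \int[P]_x g x.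
Proof. by move=> bf bg; rewrite RintegralB//; exact: bmf_integrable. Qed.

Lemma bmf_intZ a f : bmf f -> \int[P]_x (a * f x) = a * \int[P]_x f x.
Proof. by move=> bf; rewrite RintegralZl//; exact: bmf_integrable. Qed.

Lemma bmf_int_cst a : \int[P]_x a = a.
Proof.
rewrite Rintegral_cst// -[RHS]mulr1; congr (_ * _).
by transitivity (fine (1%E : \bar R)) => //; congr fine; exact: probability_setT.
Qed.

Lemma bmf_int_le f g : bmf f -> bmf g -> (forall x, f x <= g x) ->
  \int[P]_x f x <= \int[P]_x g x.
Proof. by move=> bf bg fg; apply: le_Rintegral => //; exact: bmf_integrable. Qed.

Lemma bmf_int_sum (I : Type) (s : seq I) (f : I -> T -> R) :
  (forall i, bmf (f i)) ->
  \int[P]_x (\sum_(i <- s) f i x) = \sum_(i <- s) \int[P]_x f i x.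
Proof.
move=> bf; elim: s => [|i s IH].
  by under eq_Rintegral do rewrite big_nil; rewrite bmf_int_cst big_nil.
under eq_Rintegral do rewrite big_cons.
by rewrite big_cons bmf_intD ?IH//; exact: bmf_sum.
Qed.

End bounded_measurable.

Lemma bmf_comp {d d' : measure_display} {T : measurableType d} {U : measurableType d'}
    {R : realType} (f : U -> R) (a : T -> U) :
  measurable_fun setT a -> bmf f -> bmf (fun x => f (a x)).
Proof.
move=> ma [mf [M HM]]; split; first exact: (measurableT_comp mf ma).
by exists M => x.
Qed.

Lemma bmv_comp {d d' : measure_display} {T : measurableType d} {U : measurableType d'}
    {R : realType} k (f : U -> 'rV[R]_k) (a : T -> U) :
  measurable_fun setT a -> bmv f -> bmv (fun x => f (a x)).
Proof.
move=> ma [mf [M HM]]; split; first by move=> j; exact: (measurableT_comp (mf j) ma).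
by exists M => x.
Qed.

(** * Integrating out an independent variable *)

Section independence.
Context {dO dW dT : measure_display} {Om : measurableType dO}
  {W : measurableType dW} {T : measurableType dT} {R : realType}.
Context (P : probability Om R) (rho : probability T R).

Lemma bmf_fubini_F (f : W * T -> R) (a : Om -> W) : measurable_fun setT a -> bmf f ->
  bmf (fun w => \int[rho]_p f (a w, p)).
Proof.
move=> ma bf.
have bfw w : bmf (fun p => f (w, p)).
  by apply: (bmf_comp (a := fun p => (w, p))) => //; apply: measurable_fun_pair.
have [M HM] := bf.2.
apply: (bmf_comp (f := fun w => \int[rho]_p f (w, p))) => //; split; last first.
  exists M => w; rewrite ler_norml; apply/andP; split.
    rewrite -[X in X <= _](bmf_int_cst rho); apply: bmf_int_le => // [|p]; first exact: bmf_cst.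
    by have := HM (w, p); rewrite ler_norml => /andP[].
  rewrite -[X in _ <= X](bmf_int_cst rho); apply: bmf_int_le => // [|p]; first exact: bmf_cst.
  by have := HM (w, p); rewrite ler_norml => /andP[].
(* [W] carries no measure of its own; the law of [a] supplies the one needed for the product. *)
pose a' : {mfun Om >-> W} := HB.pack a (isMeasurableFun.Build _ _ _ _ a ma).
have := @measurable_fubini_F _ _ _ _ _ (distribution P a') rho (EFin \o f) _.
move=> H; apply/measurable_EFinP.
have -> : EFin \o (fun w => \int[rho]_p f (w, p)) = fubini_F rho (EFin \o f).
  by apply/funext => w /=; rewrite -bmf_EFin.
apply: H; exact: (bmf_integrable (product_measure1 _ _)).
Qed.

(** The law of the pair agrees with the product of the law of [a] and [rho] on rectangles, hence
    everywhere; change of variables and Fubini conclude. *)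
Lemma indep_fubini (f : W * T -> R) (a : Om -> W) (b : Om -> T) :
  measurable_fun setT a -> measurable_fun setT b ->
  (forall A B, measurable A -> measurable B ->
     P (a @^-1` A `&` b @^-1` B) = (P (a @^-1` A) * rho B)%E) ->
  bmf f ->
  \int[P]_w f (a w, b w) = \int[P]_w (\int[rho]_p f (a w, p)).
Proof.
move=> ma mb ind bf.
pose ab w := (a w, b w).
have mab : measurable_fun setT ab by exact: measurable_fun_pair.
pose a' : {mfun Om >-> W} := HB.pack a (isMeasurableFun.Build _ _ _ _ a ma).
pose ab' : {mfun Om >-> (W * T)%type} := HB.pack ab (isMeasurableFun.Build _ _ _ _ ab mab).
pose m1 := distribution P a'.
have prodE X : measurable X -> (m1 \x rho)%E X = distribution P ab' X.
  by apply: product_measure_unique => A B mA mB; exact: ind.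
have mf : measurable_fun setT (EFin \o f) by apply/measurable_EFinP; case: bf.
have bfw w : bmf (fun p => f (w, p)).
  by apply: (bmf_comp (a := fun p => (w, p))) => //; apply: measurable_fun_pair.
have if1 : (m1 \x rho)%E.-integrable setT (EFin \o f).
  exact: (bmf_integrable (product_measure1 _ _)).
have -> : \int[P]_w f (a w, b w) = fine (\int[distribution P ab']_z (f z)%:E)%E.
  rewrite /Rintegral (@integral_distribution _ _ _ _ _ P ab' (EFin \o f))//.
  by apply: (bmf_integrable P (f := f \o ab)); exact: bmf_comp.
rewrite -(eq_measure_integral _ (fun A mA _ => prodE A mA)).
rewrite -(integral12_prod_meas1 if1).
rewrite (@integral_distribution _ _ _ _ _ P a')//.
- congr fine; apply: eq_integral => w _ /=.
  by rewrite /fubini_F -bmf_EFin.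
- exact: measurable_fubini_F if1.
- have -> : fubini_F rho (EFin \o f) \o a' = EFin \o (fun w => \int[rho]_p f (a w, p)).
    by apply/funext => w /=; rewrite /fubini_F bmf_EFin.
  by apply: bmf_integrable; exact: bmf_fubini_F.
Qed.

End independence.

(** * Independence of a fresh sample from the earlier ones *)

Section past.
Context {dO dT : measure_display} {Om : measurableType dO} {T : measurableType dT}
  {R : realType} (P : probability Om R) (rho : probability T R).
Context (xi : nat -> Om -> T) (n : nat).
Hypothesis xi_m : forall i, measurable_fun setT (xi i).
Hypothesis xi_law : forall i (A : set T), (i < n)%N -> measurable A ->
  P (xi i @^-1` A) = rho A.
Hypothesis xi_indep : indep_first P xi n.

(** A pi-system generating the sigma-algebra of the first [i] samples. The past is then the identity
    map from [Om] to [Om] with this coarser structure, with no product space to build. *)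
Definition past_rect (i : nat) : set (set Om) :=
  [set E | exists A : nat -> set T, (forall j, measurable (A j)) /\
     E = \bigcap_(j in [set j | (j < i)%N]) (xi j @^-1` A j)].

Local Notation past i := (g_sigma_algebraType (past_rect i)).

Let xi_preim_m j A : measurable A -> measurable (xi j @^-1` A).
Proof. by move=> mA; rewrite -[X in measurable X]setTI; exact: xi_m. Qed.

Lemma past_rect_measurable i : past_rect i `<=` measurable.
Proof.
by move=> _ [A [mA ->]]; apply: bigcap_measurableType => j _; exact: xi_preim_m.
Qed.

Lemma past_measurable i (E : set (past i)) : measurable E -> measurable (E : set Om).
Proof.
move=> mE; apply: (smallest_sub _ (@past_rect_measurable i) mE).
exact: sigma_algebra_measurable.
Qed.

Lemma measurable_id_past i : @measurable_fun _ _ Om (past i) setT (fun w => w).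
Proof. by move=> _ E mE; rewrite setTI; exact: (@past_measurable i E mE). Qed.

Lemma past_coord i j : (j < i)%N -> @measurable_fun _ _ (past i) T setT (xi j).
Proof.
move=> ji _ A mA; rewrite setTI; apply: sub_sigma_algebra.
exists (fun l => if l == j then A else setT); split; first by move=> l; case: ifP.
apply/seteqP; split => [w Aw l _ /=|w /(_ j ji)]; last by rewrite eqxx.
by case: eqP => [->|].
Qed.

(** As functions of [A], both sides are finite measures that agree on the generating rectangles, so
    they agree on the whole past. *)
Lemma indep_past i A B : (i < n)%N -> measurable (A : set (past i)) -> measurable B ->
  P ((A : set Om) `&` xi i @^-1` B) = (P (A : set Om) * rho B)%E.
Proof.
move=> iltn mA mB.
have mx := @xi_preim_m i B mB.
have rB0 : 0 <= fine (rho B) by rewrite fine_ge0.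
pose m1 : {measure set Om -> \bar R} := mrestr P mx.
pose m2 : {measure set Om -> \bar R} := mscale (NngNum rB0) P.
suff -> : P (A `&` xi i @^-1` B) = m2 A.
  change ((fine (rho B))%:E * P (A : set Om) = P (A : set Om) * rho B)%E.
  by rewrite muleC fineK//; exact: fin_num_measure.
change (m1 A = m2 A).
apply: (@g_sigma_algebra_measure_unique _ _ _ (past_rect i)
  (@past_rect_measurable i) (fun=> setT)) => //.
- move=> _; exists (fun=> setT); split => //; by apply/seteqP; split.
- by apply/seteqP; split => // x _; exists 0%N.
- move=> _ _ [A1 [mA1 ->]] [A2 [mA2 ->]]; exists (fun j => A1 j `&` A2 j).
  split; first by move=> j; exact: measurableI.
  apply/seteqP; split => [w [H1 H2] j ji|w H]; first by split; [exact: H1|exact: H2].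
  by split => j ji; case: (H j ji).
- move=> _ [A1 [mA1 ->]].
  set E1 := \bigcap_(j in _) _.
  change (P (E1 `&` xi i @^-1` B) = (fine (rho B))%:E * P E1)%E; rewrite /E1 {E1}.
  (* Independence is given for exactly [n] factors; shorter rectangles are padded with [setT], whose
     factors are 1. *)
  have prodP (I : nat -> set T) m : (forall j, measurable (I j)) -> (m <= n)%N ->
      P (\bigcap_(j in [set j | (j < m)%N]) (xi j @^-1` I j)) =
      (\prod_(j < m) rho (I j))%E.
    move=> mI mn.
    pose I' j := if (j < m)%N then I j else setT.
    have mI' j : measurable (I' j) by rewrite /I'; case: ifP.
    have -> : \bigcap_(j in [set j | (j < m)%N]) (xi j @^-1` I j) =
       \bigcap_(j in [set j | (j < n)%N]) (xi j @^-1` I' j).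
      apply/seteqP; split => w H j /= jn.
        by rewrite /I'; case: ifPn => // jm; exact: H.
      by have := H j (leq_trans jn mn); rewrite /I' jn.
    rewrite xi_indep// (big_ord_widen n (fun j => rho (I j)) mn) [RHS]big_mkcond/=.
    apply: eq_bigr => j _; rewrite xi_law// /I'.
    by case: ifP => // _; rewrite probability_setT.
  (* Placing [B] in slot [i] gives a rectangle of length [i.+1], still at most [n]. *)
  pose I j := if j == i then B else A1 j.
  have -> : \bigcap_(j in [set j | (j < i)%N]) (xi j @^-1` A1 j) `&` xi i @^-1` B =
     \bigcap_(j in [set j | (j < i.+1)%N]) (xi j @^-1` I j).
    apply/seteqP; split => [w [H1 H2] j /=|w H].
      by rewrite ltnS leq_eqVlt /I; case: eqP => [->//|_ /= ji]; exact: H1.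
    split; last by have := H i (ltnSn i); rewrite /I eqxx.
    move=> j /= ji; have := H j (ltn_trans ji (ltnSn i)).
    by rewrite /I ltn_eqF.
  rewrite prodP//; last by move=> j; rewrite /I; case: ifP.
  rewrite prodP//; last exact: ltnW.
  rewrite big_ord_recr/= /I eqxx muleC fineK; last exact: fin_num_measure.
  by congr (_ * _)%E; apply: eq_bigr => j _; rewrite ltn_eqF.
- by move=> _; rewrite /m1 /mrestr/= (le_lt_trans (probability_le1 _ _)) ?ltry//;
    exact: measurableI.
Qed.

Lemma past_fubini i (f : past i * T -> R) : (i < n)%N -> bmf f ->
  \int[P]_w f (w, xi i w) = \int[P]_w (\int[rho]_p f (w, p)).
Proof.
move=> iltn bf.
apply: (@indep_fubini _ _ _ _ (past i) _ _ P rho f (fun w => w) (xi i)) => //.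
  exact: measurable_id_past.
by move=> A B mA mB; exact: indep_past.
Qed.

End past.

(** * Joint measurability of the iterates *)

Section joint_measurability.
Context {R : realType} {dX dW : measure_display} {X : measurableType dX}
  {W : measurableType dW} {Y : finType} (y0 : Y) {k : nat}.
Context (Hs : set (X -> R)) (ip : (X -> R) -> (X -> R) -> R) (kk : X -> X -> R).
Hypothesis Hrkhs : is_rkhs Hs ip kk.
Hypothesis kk_m : measurable_fun setT (fun p : X * X => kk p.1 p.2).
Context (D eta : R).
Hypothesis D0 : 0 < D.
Context (G : 'rV[R]_k -> 'rV[R]_k) (phi : Y -> 'rV[R]_k).
Hypothesis G_cont : forall j, continuous (fun v => G v 0 j).
Local Notation gradS := (fun v y => G v - phi y).
Local Notation iter := (asgd_iter ip kk D eta gradS).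

(** The projection factor as a function of the squared norm; in this form it is nonincreasing on the
    line, hence measurable. *)
Definition shrink (q : R) : R := if q <= D ^+ 2 then 1 else D / Num.sqrt q.

Lemma measurable_shrink : measurable_fun setT shrink.
Proof.
apply: nonincreasing_measurable => // x y xy; rewrite /shrink.
have sD z : D ^+ 2 < z -> D < Num.sqrt z.
  by move=> Dz; rewrite -(gtr0_norm D0) -sqrtr_sqr ltr_sqrt// (le_lt_trans _ Dz)// sqr_ge0.
have [yD|yD] := leP y (D ^+ 2); first by rewrite (le_trans xy).
have [xD|xD] := leP x (D ^+ 2).
  by rewrite ler_pdivrMr ?mul1r ?(lt_trans D0)// ?sD// ltW// sD.
rewrite ler_wpM2l ?(ltW D0)// lef_pV2 ?posrE ?(lt_trans D0)// ?sD//.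
by rewrite ler_wsqrtr.
Qed.

Lemma projG_shrink (g : X -> 'rV[R]_k) : inG Hs g ->
  projG ip D g = (fun x => shrink (ipG ip g g) *: g x).
Proof.
move=> Hg; rewrite /projG (normG_le_sqr Hrkhs D0 Hg) /shrink.
by case: ifP => // _; apply/funext => x; rewrite scale1r.
Qed.

Lemma measurable_vec_cont {d : measure_display} {T : measurableType d} (g : T -> 'rV[R]_k) :
  measurable_vec g -> measurable_vec (fun x => G (g x)).
Proof. by move=> mg j; exact: (measurable_fun_continuous_vec (@G_cont j) mg). Qed.

Lemma measurable_fin_snd {d : measure_display} {T : measurableType d}
    (u : T -> X * pdiscr y0) : measurable_fun setT u ->
  @measurable_fin _ T Y (fun w => (u w).2).
Proof.
move=> mu A; have mu2 := measurableT_comp measurable_snd mu.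
by have := mu2 measurableT A Logic.I; rewrite setTI.
Qed.

(** Both claims need a common induction: the new values contain the projection factor, a function of
    the norm, and the new norm contains values. [W] is arbitrary so as to cover [Om], its past
    sigma-algebras and, for a fixed path, [unit]. *)
Lemma asgd_iter_measurable (s : nat -> W -> X * pdiscr y0) m :
  (forall i, (i < m)%N -> measurable_fun setT (s i)) ->
  measurable_fun setT (fun w => ipG ip (iter (s^~ w) m) (iter (s^~ w) m)) /\
  measurable_vec (fun z : W * X => iter (s^~ z.1) m z.2).
Proof.
elim: m => [_|m IH ms].
  split; last by move=> j /=; exact: measurable_cst.
  exact: (@measurable_cst _ _ _ _ setT (ipG ip (fun=> 0) (fun=> 0 : 'rV[R]_k))).
have [IH1 IH2] := IH (fun i im => ms i (ltn_trans im (ltnSn m))).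
have mm := ms m (ltnSn m); set g := fun w => iter (s^~ w) m in IH1 IH2.
have mx : measurable_fun setT (fun w => (s m w).1).
  exact: (measurableT_comp measurable_fst mm).
have mgx : measurable_vec (fun w => g w (s m w).1).
  move=> j; apply: (measurableT_comp (IH2 j) (g := fun w => (w, (s m w).1))).
  exact: measurable_fun_pair.
pose q w := G (g w (s m w).1) - phi (s m w).2.
have mq : measurable_vec q.
  apply: measurable_vecB; first exact: measurable_vec_cont.
  by move=> j; exact: (measurable_fin_fun (fun y => phi y 0 j) (measurable_fin_snd mm)).
have gin w : inG Hs (g w) by exact: (asgd_iter_in Hrkhs).
pose g' w x := g w x - (eta * kk (s m w).1 x) *: q w.
have g'in w : inG Hs (g' w) by exact: (asgd_step_in Hrkhs eta gradS (s m w) (gin w)).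
pose N w := ipG ip (g' w) (g' w).
have mN : measurable_fun setT N.
  have -> : N = (fun w => eta ^+ 2 * (kk (s m w).1 (s m w).1 * dotv (q w) (q w))
      - 2 * eta * dotv (q w) (g w (s m w).1) + ipG ip (g w) (g w)).
    by apply/funext => w; exact: (asgd_step_sqr Hrkhs eta gradS (s m w) (gin w)).
  apply: measurable_funD => //; apply: measurable_funB; last first.
    by apply: measurable_funM => //; exact: measurable_dotv.
  apply: measurable_funM => //; apply: measurable_funM; last exact: measurable_dotv.
  apply: (measurableT_comp kk_m (g := fun w => ((s m w).1, (s m w).1))).
  exact: measurable_fun_pair.
have iterE w : iter (s^~ w) m.+1 = (fun x => shrink (N w) *: g' w x).
  by rewrite /= -/(g w) (projG_shrink (g'in w)).
have msh : measurable_fun setT (fun w => shrink (N w)).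
  exact: (measurableT_comp measurable_shrink mN).
split.
  have -> : (fun w => ipG ip (iter (s^~ w) m.+1) (iter (s^~ w) m.+1)) =
     (fun w => shrink (N w) ^+ 2 * N w).
    by apply/funext => w; rewrite iterE (ipG_sqrZ Hrkhs).
  by apply: measurable_funM => //; exact: measurable_funX.
have -> : (fun z : W * X => iter (s^~ z.1) m.+1 z.2) =
    (fun z => shrink (N z.1) *: g' z.1 z.2).
  by apply/funext => z; rewrite iterE.
apply: measurable_vecZ; first exact: (measurableT_comp msh measurable_fst).
apply: measurable_vecB; first exact: IH2.
apply: measurable_vecZ; last by move=> j; exact: (measurableT_comp (mq j) measurable_fst).
apply: measurable_funM => //.
apply: (measurableT_comp kk_m (g := fun z : W * X => ((s m z.1).1, z.2))).
apply: measurable_fun_pair; last exact: measurable_snd.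
exact: (measurableT_comp mx measurable_fst).
Qed.

End joint_measurability.

(** * Measurability of the conjugate and its gradient *)

Section conjugate_measurability.
Context {R : realType} {k : nat} (Dom : set 'rV[R]_k) (h : 'rV[R]_k -> R).
Hypothesis Dom0 : Dom !=set0.
Hypothesis Dconv : convex_setv Dom.
Hypothesis Hfin : forall v, has_ubound [set dotv v u - h u | u in Dom].
Hypothesis Hdiff : forall v, differentiable (fconj Dom h) v.
Context (beta : R).
Hypothesis beta0 : 0 < beta.
Hypothesis Hsc : strongly_convex_on Dom h beta^-1.
Local Notation F := (fconj Dom h).
Local Notation gF := (grad F).

(** The crude factor [k.+1] is nonzero also in dimension 0, so it can be divided by. *)
Lemma norm2_le_coord (u : 'rV[R]_k) (e : R) : 0 <= e ->
  (forall j, `|u 0 j| <= e) -> norm2 u <= k.+1%:R * e.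
Proof.
move=> e0 ue; rewrite -(@ler_pXn2r _ 2) ?nnegrE ?norm2_ge0 ?mulr_ge0//.
rewrite norm2_sqr exprMn; apply: (@le_trans _ _ (k%:R * e ^+ 2)).
  rewrite -[k in k%:R]card_ord mulr_natl -sumr_const; apply: ler_sum => j _.
  by rewrite -expr2 -real_normK ?num_real// ler_pXn2r ?nnegrE.
rewrite ler_wpM2r ?sqr_ge0// -natrX ler_nat; apply: (leq_trans (leqnSn k)).
by rewrite expnS expn1 leq_pmulr.
Qed.

Lemma grad_fconj_continuous j : continuous (fun v => gF v 0 j).
Proof.
move=> v; apply/(@cvgrPdist_lt _ _ _ (nbhs v) (nbhs_filter v)) => e e0.
have d0 : 0 < e / (2 * beta * k.+1%:R) by rewrite divr_gt0// !mulr_gt0.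
near=> w.
have [_ vw] : ball v (e / (2 * beta * k.+1%:R)) w by near: w; exact: nbhsx_ballx.
have := @norm2_le_coord (v - w) _ (ltW d0).
have vw' i : `|(v - w) 0 i| <= e / (2 * beta * k.+1%:R).
  by rewrite !mxE ltW//; exact: vw.
move=> /(_ vw') nvw.
have -> : gF v 0 j - gF w 0 j = (gF v - gF w) 0 j by rewrite !mxE.
apply: le_lt_trans (coord_le_norm2 _ _) _.
apply: le_lt_trans (grad_fconj_lipschitz Dom0 Dconv Hfin Hdiff beta0 Hsc v w) _.
apply: le_lt_trans (ler_wpM2l (ltW beta0) nvw) _.
have -> : beta * (k.+1%:R * (e / (2 * beta * k.+1%:R))) = e / 2.
  have k0 : k.+1%:R != 0 :> R by rewrite pnatr_eq0.
  by move: (k.+1%:R : R) k0 => K k0; field; rewrite k0 gt_eqF.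
lra.
Unshelve. all: by end_near. Qed.

Context {d : measure_display} {T : measurableType d}.
Implicit Types f g : T -> 'rV[R]_k.

Lemma bmv_grad_fconj g : bmv g -> bmv (fun x => gF (g x)).
Proof.
move=> [mg [M HM]]; split.
  by move=> j; exact: (measurable_fun_continuous_vec (@grad_fconj_continuous j) mg).
exists (beta * M + norm2 (gF 0)) => x.
have -> : gF (g x) = (gF (g x) - gF 0) + gF 0 by rewrite subrK.
apply: le_trans (norm2_triangle _ _) _; rewrite lerD2r.
apply: le_trans (grad_fconj_lipschitz Dom0 Dconv Hfin Hdiff beta0 Hsc _ _) _.
by rewrite subr0 ler_wpM2l// ltW.
Qed.

(** Boundedness: [F] lies above its tangent at 0, and below it plus a quadratic. *)
Lemma bmf_fconj g : bmv g -> bmf (fun x => F (g x)).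
Proof.
move=> bg; split.
  apply: (measurable_fun_continuous_vec (F := F)); last by case: bg.
  by move=> v; exact: differentiable_continuous.
have [N HN] : exists N, forall x, `|beta / 2 * dotv (g x) (g x)| <= N.
  by apply: proj2; apply: bmfZ; exact: bmv_dotv.
have [M HM] : exists M, forall x, `|F 0 + dotv (gF 0) (g x)| <= M.
  apply: proj2; apply: bmfD; first exact: bmf_cst.
  by apply: bmv_dotv => //; split; [exact: measurable_vec_cst|exists (norm2 (gF 0))].
exists (M + N) => x.
have := bregman_ge0 Dom0 Hfin Hdiff (g x) 0.
have := bregman_le Dom0 Dconv Hfin Hdiff beta0 Hsc (g x) 0.
rewrite /bregman subr0 => H1 H2.
move: (HM x) (HN x); rewrite !ler_norml => /andP[? ?] /andP[? ?].
apply/andP; split; lra.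
Qed.

Lemma bmf_bregman f g : bmv f -> bmv g -> bmf (fun x => bregman Dom h (f x) (g x)).
Proof.
move=> bf bg; apply: bmfB; first by apply: bmfB; exact: bmf_fconj.
by apply: bmv_dotv; [exact: bmv_grad_fconj|exact: bmvB].
Qed.

End conjugate_measurability.

(** * First-order optimality and the excess risk of decoding *)

Lemma quadratic_ge0_linear0 (R : realFieldType) (A Q : R) :
  (forall s, 0 <= s * A + s ^+ 2 * Q) -> A = 0.
Proof.
move=> H; have Q0 : 0 <= Q.
  by have := H 1; have := H (-1); rewrite sqrrN !expr1n !mul1r mulN1r; lra.
(* This point gives the value [- (A / (Q + 1))^2]; [Q + 1] keeps it meaningful when [Q = 0]. *)
have := H (- A / (Q + 1)).
have -> : - A / (Q + 1) * A + (- A / (Q + 1)) ^+ 2 * Q = - (A / (Q + 1)) ^+ 2.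
  by field; rewrite gt_eqF// ltr_wpDl.
rewrite oppr_ge0 => H2.
have : (A / (Q + 1)) ^+ 2 == 0 by rewrite eq_le H2 sqr_ge0.
by rewrite sqrf_eq0 mulf_eq0 invr_eq0 [Q + 1 == 0]gt_eqF ?ltr_wpDl// orbF => /eqP.
Qed.

Section excess_risk.
Context {R : realType} {dX : measure_display} {X : measurableType dX}
  {Y Z : finType} (y0 : Y) (z0 : Z) {k : nat}
  (psi : Z -> 'rV[R]_k) (phi : Y -> 'rV[R]_k) (c : R).
Context (Dom : set 'rV[R]_k) (h : 'rV[R]_k -> R).
Hypothesis Dom0 : Dom !=set0.
Hypothesis Dconv : convex_setv Dom.
Hypothesis Hfin : forall v, has_ubound [set dotv v u - h u | u in Dom].
Hypothesis Hdiff : forall v, differentiable (fconj Dom h) v.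
Context (beta : R).
Hypothesis beta0 : 0 < beta.
Hypothesis Hsc : strongly_convex_on Dom h beta^-1.
Context (rho : probability (X * pdiscr y0)%type R).
Context (gs : X -> 'rV[R]_k).
Hypothesis gs_bmv : bmv gs.
Hypothesis gs_opt : forall g : X -> 'rV[R]_k, measurable_vec g ->
  (\int[rho]_p (Sloss Dom h phi (gs p.1) p.2)%:E <=
   \int[rho]_p (Sloss Dom h phi (g p.1) p.2)%:E)%E.
Local Notation F := (fconj Dom h).
Local Notation gF := (grad F).
Local Notation XY := (X * pdiscr y0)%type.

Lemma bmv_fst (v : X -> 'rV[R]_k) : bmv v -> bmv (fun p : XY => v p.1).
Proof. by move=> bv; apply: bmv_comp => //; exact: measurable_fst. Qed.

Lemma bmv_phi : bmv (fun p : XY => phi p.2).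
Proof.
apply: (@bmv_fin _ XY R k Y phi (fun p => p.2)).
exact: (@measurable_fin_snd _ X Y y0 _ XY (fun p => p)).
Qed.

Lemma bmf_Sloss (v : X -> 'rV[R]_k) : bmv v ->
  bmf (fun p : XY => Sloss Dom h phi (v p.1) p.2).
Proof.
move=> bv; apply: bmfB; last by apply: bmv_dotv; [exact: bmv_phi|exact: bmv_fst].
apply: bmfD; first exact: (bmf_fconj Dom0 Dconv Hfin Hdiff beta0 Hsc (bmv_fst bv)).
split; last first.
  exists (\sum_y `|h (phi y)|) => p.
  by rewrite (bigD1 (p.2 : Y))//= lerDl sumr_ge0.
apply: (@measurable_fin_fun _ XY R Y (fun p => p.2) (fun y => h (phi y))).
exact: (@measurable_fin_snd _ X Y y0 _ XY (fun p => p)).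
Qed.

(** Weak form of the conditional mean identity, tested against functions of [x]. The smoothness
    bound along [gs + s v] makes the risk increment at most a quadratic in [s], so nothing is
    differentiated under the integral. *)
Lemma first_order_optimality (v : X -> 'rV[R]_k) : bmv v ->
  \int[rho]_p dotv (v p.1) (gF (gs p.1) - phi p.2) = 0.
Proof.
move=> bv.
have bA : bmf (fun p : XY => dotv (v p.1) (gF (gs p.1) - phi p.2)).
  apply: bmv_dotv; first exact: bmv_fst.
  apply: bmvB; last exact: bmv_phi.
  exact: (bmv_grad_fconj Dom0 Dconv Hfin Hdiff beta0 Hsc (bmv_fst gs_bmv)).
have bQ : bmf (fun p : XY => beta / 2 * dotv (v p.1) (v p.1)).
  by apply: bmfZ; apply: bmv_dotv; exact: bmv_fst.
apply: (@quadratic_ge0_linear0 _ _ (\int[rho]_p (beta / 2 * dotv (v p.1) (v p.1)))) => s.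
have bw : bmv (fun x => gs x + s *: v x) by apply: bmvD => //; exact: bmvZ.
have := gs_opt bw.1.
have bS1 := bmf_Sloss gs_bmv; have bS2 := bmf_Sloss bw.
rewrite (bmf_EFin rho bS1) (bmf_EFin rho bS2) lee_fin => H.
rewrite -bmf_intZ// -bmf_intZ// -bmf_intD//; [|exact: bmfZ|exact: bmfZ].
rewrite -(lerD2l (\int[rho]_p Sloss Dom h phi (gs p.1) p.2)) addr0.
apply: le_trans H _.
have bR : bmf (fun p : XY => s * dotv (v p.1) (gF (gs p.1) - phi p.2) +
            s ^+ 2 * (beta / 2 * dotv (v p.1) (v p.1))).
  by apply: bmfD; exact: bmfZ.
rewrite -bmf_intD//; apply: bmf_int_le => // [|p]; first exact: bmfD.
have := fconj_grad_le Dom0 Dconv Hfin Hdiff beta0 Hsc (gs p.1) (s *: v p.1).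
rewrite /Sloss /=; move: (gs p.1) (v p.1) (phi p.2) => g w f.
rewrite !(dotvDl, dotvDr, dotvNr, dotvZl, dotvZr) (dotvC w (gF g)) (dotvC w f); lra.
Qed.

Lemma bmf_Lloss (u : X -> Z) : measurable_fin u ->
  bmf (fun p : XY => Lloss psi phi c (u p.1) p.2).
Proof.
move=> mu; apply: bmfD; last exact: bmf_cst.
by apply: bmv_dotv; [apply: (bmv_fst (v := psi \o u)); exact: bmv_fin|exact: bmv_phi].
Qed.

(** The test direction [psi \o u] in the optimality condition replaces [phi] of the label by
    [gF (gs x)]. *)
Lemma riskE_grad (u : X -> Z) : measurable_fin u ->
  \int[rho]_p Lloss psi phi c (u p.1) p.2 =
  \int[rho]_p dotv (psi (u p.1)) (gF (gs p.1)) + c.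
Proof.
move=> mu; have bu : bmv (fun x => psi (u x)) by exact: bmv_fin.
have bg := bmv_grad_fconj Dom0 Dconv Hfin Hdiff beta0 Hsc (bmv_fst gs_bmv).
have b1 : bmf (fun p : XY => dotv (psi (u p.1)) (gF (gs p.1))).
  by apply: bmv_dotv => //; exact: (bmv_fst bu).
have b2 : bmf (fun p : XY => dotv (psi (u p.1)) (phi p.2)).
  by apply: bmv_dotv; [exact: (bmv_fst bu)|exact: bmv_phi].
have := first_order_optimality bu.
have -> : (fun p : XY => dotv (psi (u p.1)) (gF (gs p.1) - phi p.2)) =
   (fun p => dotv (psi (u p.1)) (gF (gs p.1)) - dotv (psi (u p.1)) (phi p.2)).
  by apply/funext => p; rewrite dotvDr dotvNr.
rewrite bmf_intB// => /eqP; rewrite subr_eq0 => /eqP ->.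
by rewrite /Lloss bmf_intD ?bmf_int_cst//; exact: bmf_cst.
Qed.

Lemma zdec_min (u : 'rV[R]_k) z : dotv (psi (zdec z0 psi u)) u <= dotv (psi z) u.
Proof. by rewrite /zdec; case: arg_minP => // i _; apply. Qed.

Lemma cpsi_ge z : norm2 (psi z) <= \big[Num.max/0]_(z : Z) norm2 (psi z).
Proof. exact: le_bigmax. Qed.

(** Pointwise: the decoded output is optimal for [gF (g x)], so replacing this by [gF (gs x)] costs
    the gradient gap once for each of the two outputs compared. *)
Lemma excess_risk_le (g : X -> 'rV[R]_k) (u : X -> Z) (t : R) :
  bmv g -> measurable_fin u -> 0 < t ->
  \int[rho]_p Lloss psi phi c (legendre_decode z0 psi Dom h (g p.1)) p.2 -
  \int[rho]_p Lloss psi phi c (u p.1) p.2 <=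
  (\big[Num.max/0]_(z : Z) norm2 (psi z)) *
    (t + 2 * beta / t * \int[rho]_p bregman Dom h (g p.1) (gs p.1)).
Proof.
move=> bg mu t0; set cp := \big[Num.max/0]_(z : Z) norm2 (psi z).
have cp0 : 0 <= cp by exact: le_trans (norm2_ge0 (psi z0)) (cpsi_ge z0).
have bG := bmv_grad_fconj Dom0 Dconv Hfin Hdiff beta0 Hsc bg.
have md : measurable_fin (legendre_decode z0 psi Dom h \o g).
  exact: (measurable_zdec z0 psi bG.1).
have bgs := bmv_grad_fconj Dom0 Dconv Hfin Hdiff beta0 Hsc (bmv_fst gs_bmv).
have b1 w : measurable_fin w -> bmf (fun p : XY => dotv (psi (w p.1)) (gF (gs p.1))).
  move=> mw; apply: bmv_dotv => //; apply: (bmv_fst (v := psi \o w)); exact: bmv_fin.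
have bB : bmf (fun p : XY => bregman Dom h (g p.1) (gs p.1)).
  by apply: (bmf_bregman Dom0 Dconv Hfin Hdiff beta0 Hsc); exact: bmv_fst.
rewrite (riskE_grad md) (riskE_grad mu) opprD addrACA subrr addr0.
rewrite -bmf_intB; [|exact: (b1 _ md)|exact: b1].
rewrite -[X in _ * (X + _)](bmf_int_cst rho) -bmf_intZ// -bmf_intD//; last first.
- exact: bmfZ.
- exact: bmf_cst.
rewrite -bmf_intZ; last by apply: bmfD; [exact: bmf_cst|exact: bmfZ].
apply: bmf_int_le => [||p].
- by apply: bmfB; [exact: (b1 _ md)|exact: b1].
- by apply: bmfZ; apply: bmfD; [exact: bmf_cst|exact: bmfZ].
rewrite /legendre_decode /=.
have Hq := bregman_ge_grad Dom0 Dconv Hfin Hdiff beta0 Hsc (g p.1) (gs p.1).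
have Hz := zdec_min (gF (g p.1)) (u p.1).
move: Hz Hq; rewrite /legendre_decode.
move: (bregman _ _ _ _) (gF (gs p.1)) (gF (g p.1)) => B q' q; set z := zdec _ _ _ => Hz Hq.
have H1 : dotv (psi z) (q' - q) <= cp * norm2 (q - q').
  rewrite -(norm2N (q - q')) opprB; apply: le_trans (dotv_cauchy _ _) _.
  by rewrite ler_wpM2r ?norm2_ge0// cpsi_ge.
have H2 : dotv (psi (u p.1)) (q - q') <= cp * norm2 (q - q').
  apply: le_trans (dotv_cauchy _ _) _.
  by rewrite ler_wpM2r ?norm2_ge0// cpsi_ge.
(* [(t - r)^2 >= 0] with co-coercivity; the result is affine in [B] and can be integrated. *)
have H3 : 2 * norm2 (q - q') <= t + 2 * beta / t * B.
  rewrite -norm2_sqr in Hq; set r := norm2 _ in Hq *.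
  rewrite -(ler_pM2l t0).
  have -> : t * (t + 2 * beta / t * B) = t ^+ 2 + 2 * beta * B.
    by field; rewrite gt_eqF.
  have := sqr_ge0 (t - r); rewrite sqrrB; lra.
have := ler_wpM2l cp0 H3.
move: H1 H2 Hz; rewrite !dotvE; lra.
Qed.

End excess_risk.

(** * Arithmetic of the shifted average *)

Section rate.
Context {R : realType}.

(* Shifting the average from [0..n-1] to [1..n] costs the last term, which the
   terminal distance pays for when [C2 * sqrt n >= 8 / 7]. *)
Lemma shifted_average_le (e : nat -> R) (n : nat) (a D C2 : R) :
  (1 < n)%N -> 0 < a -> 0 < D -> 1 <= C2 -> (forall i, 0 <= e i) ->
  2 / a * e n + 2 * (2 / (a * C2 * Num.sqrt n%:R)) * (\sum_(i < n) e i) <= 5 * D ^+ 2 ->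
  e n <= 2 * a * D ^+ 2 ->
  n%:R^-1 * (\sum_(i < n) e i.+1) <= 2 * a * D ^+ 2 * C2 / Num.sqrt n%:R.
Proof.
move=> n1 a0 D0 C21 e0.
set sn := Num.sqrt n%:R.
have n0' : (0 : R) < n%:R by rewrite ltr0n ltnW.
have sn0 : 0 < sn by rewrite sqrtr_gt0.
have nE : n%:R = sn ^+ 2 by rewrite sqr_sqrtr// ltW.
(* For [n >= 2], since [(8/7)^2 < 2]. *)
have sn87 : 8 / 7 <= sn.
  have : (2 : R) <= n%:R by rewrite ler_nat.
  rewrite nE => H; rewrite leNgt; apply/negP => H2; nra.
have sumE : \sum_(i < n) e i.+1 = \sum_(i < n) e i - e 0%N + e n.
  have : \sum_(i < n.+1) e i = \sum_(i < n) e i + e n by rewrite big_ord_recr.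
  by rewrite big_ord_recl/= addrAC => <-; rewrite addrAC subrr add0r.
rewrite sumE; move: (\sum_(i < n) e i) => S H1 H2.
set x := e n in H1 H2 *.
set c := C2 * sn.
have c87 : 8 / 7 <= c by rewrite /c; nra.
have aD : 0 < a * D ^+ 2 by rewrite mulr_gt0// exprn_gt0.
have c0 : 0 < c by lra.
have H3 : S <= 5 / 4 * (a * D ^+ 2) * c - x * c / 2.
  have ac0 : 0 < a * c by rewrite mulr_gt0.
  have := ler_wpM2l (ltW ac0) H1.
  have -> : a * c * (2 / a * x + 2 * (2 / (a * C2 * sn)) * S) = 2 * c * x + 4 * S.
    by rewrite /c; field; rewrite !gt_eqF//; lra.
  lra.
suff H : S - e 0%N + x <= 2 * (a * D ^+ 2) * c.
  have -> : 2 * a * D ^+ 2 * C2 / sn = n%:R^-1 * (2 * (a * D ^+ 2) * c).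
    by rewrite nE /c; field; rewrite gt_eqF.
  by rewrite ler_wpM2l// invr_ge0 ltW.
move: aD H2 H3; rewrite -mulrA; move: (a * D ^+ 2) => A A0 H2 H3.
have x0 : 0 <= x by exact: e0.
(* It remains that [5/4 A c + x (1 - c/2) <= 2 A c]. For [c >= 2] the [x] term is nonpositive;
   otherwise [x <= 2 A] leaves [A c / 4 + 2 A <= 2 A c], that is [c >= 8/7]. *)
have := e0 0%N; have [c2|c2] := leP 2 c; first nra.
have : x * (2 - c) <= 2 * A * (2 - c) by rewrite ler_wpM2r// subr_ge0 ltW.
nra.
Qed.

End rate.

(** * Expected Bregman risk of the iterates *)

Section asgd_risk.
Context {R : realType} {dX : measure_display} {X : measurableType dX}
  {Y : finType} (y0 : Y) {k : nat} (phi : Y -> 'rV[R]_k).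
Context (Dom : set 'rV[R]_k) (h : 'rV[R]_k -> R).
Hypothesis Dom0 : Dom !=set0.
Hypothesis Dconv : convex_setv Dom.
Hypothesis Hfin : forall v, has_ubound [set dotv v u - h u | u in Dom].
Hypothesis Hdiff : forall v, differentiable (fconj Dom h) v.
Context (beta : R).
Hypothesis beta0 : 0 < beta.
Hypothesis Hsc : strongly_convex_on Dom h beta^-1.
Local Notation F := (fconj Dom h).
Local Notation gF := (grad F).
Local Notation XY := (X * pdiscr y0)%type.
Context (rho : probability XY R).
Context (Hs : set (X -> R)) (ip : (X -> R) -> (X -> R) -> R) (kk : X -> X -> R).
Hypothesis Hrkhs : is_rkhs Hs ip kk.
Hypothesis kk_m : measurable_fun setT (fun p : X * X => kk p.1 p.2).
Context (kappa D eta : R).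
Hypothesis kappa0 : 0 < kappa.
Hypothesis kk_le : forall x, kk x x <= kappa ^+ 2.
Hypothesis D0 : 0 < D.
Context (gs : X -> 'rV[R]_k).
Hypothesis gs_m : measurable_vec gs.
Hypothesis gs_opt : forall g : X -> 'rV[R]_k, measurable_vec g ->
  (\int[rho]_p (Sloss Dom h phi (gs p.1) p.2)%:E <=
   \int[rho]_p (Sloss Dom h phi (g p.1) p.2)%:E)%E.
Hypothesis gs_in : inG Hs gs.
Hypothesis gs_le : ipG ip gs gs <= D ^+ 2.
Local Notation gradS := (fun v y => gF v - phi y).
Local Notation iter := (asgd_iter ip kk D eta gradS).

Lemma norm2_le_sqr (u : 'rV[R]_k) (M : R) : 0 <= M -> dotv u u <= M ^+ 2 -> norm2 u <= M.
Proof. by move=> M0; rewrite -norm2_sqr ler_pXn2r// nnegrE norm2_ge0. Qed.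

Let kD0 : 0 <= kappa * D.
Proof. by rewrite mulr_ge0// ltW. Qed.

Lemma norm2_asgd_iter s i x : norm2 (iter s i x) <= kappa * D.
Proof. by apply: norm2_le_sqr => //; exact: (asgd_iter_eval_le Hrkhs). Qed.

Lemma norm2_gs x : norm2 (gs x) <= kappa * D.
Proof.
apply: norm2_le_sqr => //; apply: le_trans (eval_le Hrkhs kappa0 kk_le x gs_in) _.
by rewrite exprMn ler_wpM2l// sqr_ge0.
Qed.

Lemma bmv_gs : bmv gs.
Proof. by split => //; exists (kappa * D) => x; exact: norm2_gs. Qed.

Lemma bmv_asgd_iter {dW : measure_display} {W : measurableType dW} (s : nat -> W -> XY) m :
  (forall i, (i < m)%N -> measurable_fun setT (s i)) ->
  bmv (fun z : W * XY => iter (s^~ z.1) m z.2.1).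
Proof.
move=> ms; split; last by exists (kappa * D) => z; exact: norm2_asgd_iter.
have [_ mi] := asgd_iter_measurable Hrkhs kk_m eta D0 phi
  (@grad_fconj_continuous _ _ _ _ Dom0 Dconv Hfin Hdiff _ beta0 Hsc) ms.
move=> j; apply: (measurableT_comp (mi j) (g := fun z : W * XY => (z.1, z.2.1))).
apply: measurable_fun_pair; first exact: measurable_fst.
exact: (measurableT_comp measurable_fst measurable_snd).
Qed.

Lemma bmv_gs_snd {dW : measure_display} {W : measurableType dW} :
  bmv (fun z : W * XY => gs z.2.1).
Proof.
apply: (bmv_comp (a := fun z : W * XY => z.2.1)); last exact: bmv_gs.
exact: (measurableT_comp measurable_fst measurable_snd).
Qed.

Lemma bmf_bregman_iter {dW : measure_display} {W : measurableType dW}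
    (s : nat -> W -> XY) m :
  (forall i, (i < m)%N -> measurable_fun setT (s i)) ->
  bmf (fun z : W * XY => bregman Dom h (iter (s^~ z.1) m z.2.1) (gs z.2.1)).
Proof.
move=> ms; apply: (bmf_bregman Dom0 Dconv Hfin Hdiff beta0 Hsc); last exact: bmv_gs_snd.
exact: bmv_asgd_iter.
Qed.

Definition regret_term (s : nat -> XY) m (p : XY) : R :=
  dotv (gradS (iter s m p.1) p.2) (iter s m p.1 - gs p.1).

Lemma bmf_regret_term {dW : measure_display} {W : measurableType dW}
    (s : nat -> W -> XY) m :
  (forall i, (i < m)%N -> measurable_fun setT (s i)) ->
  bmf (fun z : W * XY => regret_term (s^~ z.1) m z.2).
Proof.
move=> ms; have bi := bmv_asgd_iter ms.
apply: bmv_dotv; last by apply: bmvB => //; exact: bmv_gs_snd.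
apply: bmvB; first exact: (bmv_grad_fconj Dom0 Dconv Hfin Hdiff beta0 Hsc bi).
apply: (bmv_comp (f := fun p : XY => phi p.2) (a := fun z : W * XY => z.2)).
  exact: measurable_snd.
exact: bmv_phi.
Qed.

Lemma bmv_asgd_iter_path (s : nat -> XY) m : bmv (iter s m).
Proof.
split; last by exists (kappa * D) => x; exact: norm2_asgd_iter.
have [_ mi] := asgd_iter_measurable (W := unit) (s := fun i _ => s i) (m := m)
  Hrkhs kk_m eta D0 phi
  (@grad_fconj_continuous _ _ _ _ Dom0 Dconv Hfin Hdiff _ beta0 Hsc)
  (fun i _ => measurable_cst (s i)).
move=> j; apply: (measurableT_comp (mi j) (g := fun x : X => (tt, x))).
exact: measurable_fun_pair.
Qed.

(** Optimality of [gs] removes the gradient at [gs], leaving the symmetrized divergence; its reverse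
    half is dropped. *)
Lemma regret_term_ge (s : nat -> XY) m :
  \int[rho]_p bregman Dom h (iter s m p.1) (gs p.1) <= \int[rho]_p regret_term s m p.
Proof.
have bi := bmv_asgd_iter_path s m.
have bi1 := @bmv_fst _ _ X Y y0 k _ bi; have bg1 := @bmv_fst _ _ X Y y0 k _ bmv_gs.
have bv : bmv (fun x => iter s m x - gs x) by apply: bmvB => //; exact: bmv_gs.
have bG := bmv_grad_fconj Dom0 Dconv Hfin Hdiff beta0 Hsc bi1.
have bGs := bmv_grad_fconj Dom0 Dconv Hfin Hdiff beta0 Hsc bg1.
have H0 := first_order_optimality Dom0 Dconv Hfin Hdiff beta0 Hsc bmv_gs gs_opt bv.
have b0 : bmf (fun p : XY => dotv (iter s m p.1 - gs p.1) (gF (gs p.1) - phi p.2)).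
  by apply: bmv_dotv; [exact: (bmv_fst y0 bv)|apply: bmvB => //; exact: bmv_phi].
have b1 : bmf (fun p : XY => dotv (gF (iter s m p.1) - gF (gs p.1)) (iter s m p.1 - gs p.1)).
  by apply: bmv_dotv; [exact: bmvB|exact: (bmv_fst y0 bv)].
have -> : regret_term s m = (fun p =>
   dotv (gF (iter s m p.1) - gF (gs p.1)) (iter s m p.1 - gs p.1) +
   dotv (iter s m p.1 - gs p.1) (gF (gs p.1) - phi p.2)).
  apply/funext => p; rewrite /regret_term (dotvC (iter s m p.1 - gs p.1)) -dotvDl.
  by rewrite addrA subrK.
rewrite bmf_intD// H0 addr0; apply: bmf_int_le => // [|p].
  exact: (bmf_bregman Dom0 Dconv Hfin Hdiff beta0 Hsc).
rewrite -bregman_sym lerDl; exact: (bregman_ge0 Dom0 Hfin Hdiff).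
Qed.

Context (C2 : R) (n : nat).
Hypothesis n0 : (0 < n)%N.
Hypothesis C21 : 1 <= C2.
Hypothesis phi_le : forall y, norm2 (phi y - gF 0) <= beta * kappa * D * (C2 - 1).
Hypothesis etaE : eta = 2 / (beta * kappa ^+ 2 * C2 * Num.sqrt n%:R).

(** Origin of the constant: the Lipschitz bound from 0 gives [beta kappa D], and the distance from
    [gF 0] to [phi y] gives the rest. *)
Lemma gradS_le v y : norm2 v <= kappa * D -> norm2 (gF v - phi y) <= beta * kappa * D * C2.
Proof.
move=> vD; have -> : gF v - phi y = (gF v - gF 0) - (phi y - gF 0).
  by rewrite opprB addrA subrK.
apply: le_trans (norm2_triangle _ _) _; rewrite norm2N.
have := phi_le y; have := grad_fconj_lipschitz Dom0 Dconv Hfin Hdiff beta0 Hsc v 0.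
rewrite subr0; have := ler_wpM2l (ltW beta0) vD; lra.
Qed.

Lemma step_noise_le (s : nat -> XY) i (q := gradS (iter s i (s i).1) (s i).2) :
  eta ^+ 2 * (kk (s i).1 (s i).1 * dotv q q) <= 4 * D ^+ 2 / n%:R.
Proof.
have q1 : dotv q q <= (beta * kappa * D * C2) ^+ 2.
  rewrite -norm2_sqr ler_pXn2r ?nnegrE ?norm2_ge0//.
    by apply: gradS_le; exact: norm2_asgd_iter.
  have C20 : 0 < C2 := lt_le_trans ltr01 C21.
  by rewrite ltW// !mulr_gt0.
have n0' : (0 : R) < n%:R by rewrite ltr0n.
have sn0 : 0 < Num.sqrt (n%:R : R) by rewrite sqrtr_gt0.
have nE : n%:R = Num.sqrt (n%:R : R) ^+ 2 by rewrite sqr_sqrtr// ltW.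
have -> : 4 * D ^+ 2 / n%:R = eta ^+ 2 * (kappa ^+ 2 * (beta * kappa * D * C2) ^+ 2).
  have C20 : 0 < C2 := lt_le_trans ltr01 C21.
  rewrite etaE; move: nE sn0; move: (Num.sqrt n%:R) => sn -> sn0.
  by field; rewrite !gt_eqF.
rewrite ler_wpM2l ?sqr_ge0//.
apply: (@le_trans _ _ (kappa ^+ 2 * dotv q q)).
  by rewrite ler_wpM2r// dotv_ge0.
by rewrite ler_wpM2l// sqr_ge0.
Qed.

(** The terminal distance is kept on the left, to bound the divergence of the last iterate. *)
Lemma regret_sum_le (s : nat -> XY) m :
  asgd_dist ip kk D eta gradS gs s m + 2 * eta * (\sum_(i < m) regret_term s i (s i)) <=
  D ^+ 2 + m%:R * (4 * D ^+ 2 / n%:R).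
Proof.
elim: m => [|m IH].
  by rewrite big_ord0 mulr0 addr0 mul0r addr0; exact: (asgd_dist0 Hrkhs).
have Hs1 := step_noise_le s m.
have : asgd_dist ip kk D eta gradS gs s m.+1 <= asgd_dist ip kk D eta gradS gs s m -
    2 * eta * regret_term s m (s m) + 4 * D ^+ 2 / n%:R.
  apply: le_trans (asgd_dist_step (eta := eta) (gradS := gradS) Hrkhs D0 gs_in gs_le erefl) _.
  by rewrite lerD2l.
rewrite big_ord_recr/= -natr1; move: IH.
move: (asgd_dist _ _ _ _ _ _ _ m) (asgd_dist _ _ _ _ _ _ _ m.+1) => d d'.
by move: (regret_term _ _ _) (\sum_(i < m) _) (4 * _ / _) => t S e; lra.
Qed.

Lemma bregman_iter_le s m x :
  bregman Dom h (iter s m x) (gs x) <=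
  beta * kappa ^+ 2 / 2 * asgd_dist ip kk D eta gradS gs s m.
Proof.
apply: le_trans (bregman_le Dom0 Dconv Hfin Hdiff beta0 Hsc _ _) _.
have := asgd_eval_dist Hrkhs D eta kappa0 kk_le gradS gs_in s m x.
move=> /(ler_wpM2l (ltW beta0)); lra.
Qed.

(** Iterate and target both take values of norm at most [kappa D]. This bound serves the last
    iterate and the case [n = 1]. *)
Lemma bregman_iter_le_cst s m x :
  bregman Dom h (iter s m x) (gs x) <= 2 * (beta * kappa ^+ 2) * D ^+ 2.
Proof.
apply: le_trans (bregman_le Dom0 Dconv Hfin Hdiff beta0 Hsc _ _) _.
have : dotv (iter s m x - gs x) (iter s m x - gs x) <= (2 * (kappa * D)) ^+ 2.
  rewrite -norm2_sqr ler_pXn2r ?nnegrE ?norm2_ge0//; last by rewrite mulr_ge0 ?kD0.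
  apply: le_trans (norm2_triangle _ _) _; rewrite norm2N.
  have := norm2_asgd_iter s m x; have := norm2_gs x; lra.
move=> /(ler_wpM2l (ltW beta0)); lra.
Qed.

Context {dO : measure_display} {Om : measurableType dO} (P : probability Om R).
Context (xi : nat -> Om -> XY).
Hypothesis xi_m : forall i, measurable_fun setT (xi i).
Hypothesis xi_law : forall i (A : set XY), (i < n)%N -> measurable A ->
  P (xi i @^-1` A) = rho A.
Hypothesis xi_indep : indep_first P xi n.

Definition breg_risk i (w : Om) : R :=
  \int[rho]_p bregman Dom h (iter (xi^~ w) i p.1) (gs p.1).

Lemma bmf_breg_risk i : bmf (breg_risk i).
Proof.
apply: (@bmf_fubini_F _ _ _ Om Om XY R P rho
  (fun z => bregman Dom h (iter (xi^~ z.1) i z.2.1) (gs z.2.1)) (fun w => w)).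
  exact: measurable_id.
by apply: bmf_bregman_iter => j _; exact: xi_m.
Qed.

Lemma bmf_breg_path s i : bmf (fun p : XY => bregman Dom h (iter s i p.1) (gs p.1)).
Proof.
by apply: (bmf_bregman Dom0 Dconv Hfin Hdiff beta0 Hsc);
  apply: bmv_fst; [exact: bmv_asgd_iter_path|exact: bmv_gs].
Qed.

Lemma breg_risk_ge0 i w : 0 <= breg_risk i w.
Proof.
rewrite -[X in X <= _](bmf_int_cst rho); apply: bmf_int_le.
- exact: bmf_cst.
- exact: bmf_breg_path.
- by move=> p; exact: (bregman_ge0 Dom0 Hfin Hdiff).
Qed.

Lemma bmf_regret i : bmf (fun w => regret_term (xi^~ w) i (xi i w)).
Proof.
apply: (@bmf_comp _ _ Om (Om * XY)%type R (fun z => regret_term (xi^~ z.1) i z.2)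
  (fun w => (w, xi i w))); first exact: measurable_fun_pair.
by apply: bmf_regret_term => j _; exact: xi_m.
Qed.

(* The iterate [i] only depends on the samples before [i], so that averaging over
   the fresh sample turns the regret into a population quantity. *)
Lemma expected_regret_ge i : (i < n)%N ->
  \int[P]_w breg_risk i w <= \int[P]_w regret_term (xi^~ w) i (xi i w).
Proof.
move=> iltn.
(* Measurability for the past sigma-algebra, not merely that of [Om], is what lets the fresh sample
   be integrated out. *)
have bp : @bmf _ (g_sigma_algebraType (past_rect xi i) * XY)%type R
    (fun z => regret_term (xi^~ z.1) i z.2).
  by apply: bmf_regret_term => j ji; exact: past_coord.
rewrite (past_fubini xi_m xi_law xi_indep iltn bp).
apply: bmf_int_le; first exact: bmf_breg_risk.
  apply: (@bmf_fubini_F _ _ _ Om Om XY R P rho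
    (fun z => regret_term (xi^~ z.1) i z.2) (fun w => w)); first exact: measurable_id.
  by apply: bmf_regret_term => j _; exact: xi_m.
by move=> w; exact: regret_term_ge.
Qed.

Lemma breg_risk_last w :
  2 / (beta * kappa ^+ 2) * breg_risk n w +
  2 * eta * (\sum_(i < n) regret_term (xi^~ w) i (xi i w)) <= 5 * D ^+ 2.
Proof.
have n0' : (0 : R) < n%:R by rewrite ltr0n.
have := regret_sum_le (xi^~ w) n.
have -> : D ^+ 2 + n%:R * (4 * D ^+ 2 / n%:R) = 5 * D ^+ 2.
  by field; rewrite gt_eqF.
apply: le_trans; rewrite lerD2r.
have a0 : 0 < beta * kappa ^+ 2 by rewrite mulr_gt0// exprn_gt0.
set d := asgd_dist _ _ _ _ _ _ _ _.
have : breg_risk n w <= beta * kappa ^+ 2 / 2 * d.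
  rewrite -[X in _ <= X](bmf_int_cst rho); apply: bmf_int_le.
  - exact: bmf_breg_path.
  - exact: bmf_cst.
  - by move=> p; exact: bregman_iter_le.
have a20 : 0 <= 2 / (beta * kappa ^+ 2) by rewrite divr_ge0// ltW.
move=> /(ler_wpM2l a20).
have -> // : 2 / (beta * kappa ^+ 2) * (beta * kappa ^+ 2 / 2 * d) = d.
by field; rewrite !gt_eqF.
Qed.

Lemma expected_bregman_le :
  n%:R^-1 * (\sum_(i < n) \int[P]_w breg_risk i.+1 w) <=
  2 * (beta * kappa ^+ 2) * D ^+ 2 * C2 / Num.sqrt n%:R.
Proof.
have a0 : 0 < beta * kappa ^+ 2 by rewrite mulr_gt0// exprn_gt0.
have e0 i : 0 <= \int[P]_w breg_risk i w.
  by apply: Rintegral_ge0 => w _; exact: breg_risk_ge0.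
have en i : \int[P]_w breg_risk i w <= 2 * (beta * kappa ^+ 2) * D ^+ 2.
  rewrite -[X in _ <= X](bmf_int_cst P); apply: bmf_int_le.
  - exact: bmf_breg_risk.
  - exact: bmf_cst.
  move=> w; rewrite -[X in _ <= X](bmf_int_cst rho); apply: bmf_int_le.
  - exact: bmf_breg_path.
  - exact: bmf_cst.
  - by move=> p; exact: bregman_iter_le_cst.
(* For [n = 1] the shift argument fails, as [1 < 8/7], but the average is one term and the uniform
   bound with [C2 >= 1] suffices. *)
have [n1|n1] := leqP n 1.
  have -> : n = 1%N by apply/eqP; rewrite eqn_leq n1.
  rewrite big_ord_recl big_ord0 addr0 invr1 mul1r sqrtr1 divr1.
  by apply: le_trans (en _) _; rewrite ler_peMr// ltW// !mulr_gt0// exprn_gt0.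
apply: (shifted_average_le n1 a0 D0 C21 e0 _ (en n)).
rewrite -etaE.
have bS : bmf (fun w => \sum_(i < n) regret_term (xi^~ w) i (xi i w)).
  by apply: bmf_sum => i; exact: bmf_regret.
have eta0 : 0 <= 2 * eta.
  have C20 : 0 <= C2 := le_trans ler01 C21.
  by rewrite mulr_ge0// etaE divr_ge0// mulr_ge0 ?sqrtr_ge0// mulr_ge0// ltW.
have -> : 5 * D ^+ 2 = \int[P]_w (5 * D ^+ 2) by rewrite bmf_int_cst.
apply: (@le_trans _ _ (\int[P]_w (2 / (beta * kappa ^+ 2) * breg_risk n w +
  2 * eta * (\sum_(i < n) regret_term (xi^~ w) i (xi i w))))); last first.
  apply: bmf_int_le; last exact: breg_risk_last; last exact: bmf_cst.
  by apply: bmfD; apply: bmfZ => //; exact: bmf_breg_risk.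
rewrite bmf_intD; [|by apply: bmfZ; exact: bmf_breg_risk|exact: bmfZ].
rewrite !bmf_intZ//; last exact: bmf_breg_risk.
rewrite lerD2l ler_wpM2l// bmf_int_sum; last by move=> i; exact: bmf_regret.
by apply: ler_sum => i _; exact: expected_regret_ge.
Qed.

End asgd_risk.

(** * Assembly of the rate *)

Unset Implicit Arguments.

Theorem theorem4p6
  (R : realType) (dX : measure_display) (X : measurableType dX)
  (Y Z : finType) (y0 : Y) (z0 : Z)
  (k : nat) (psi : Z -> 'rV[R]_k) (phi : Y -> 'rV[R]_k) (c : R)
  (* h : Legendre type on the convex set Dom containing M = hull(phi(Y)) *)
  (Dom : set 'rV[R]_k) (h : 'rV[R]_k -> R)
  (Hleg : legendre_type Dom h)
  (HM : hullY phi `<=` Dom)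
  (Hconj_fin : forall v, has_ubound [set dotv v u - h u | u in Dom])
  (Hconj_diff : forall v, differentiable (fconj Dom h) v)
  (* (1/beta)-strong convexity *)
  (beta : R) (Hbeta : 0 < beta)
  (Hsc : strongly_convex_on Dom h beta^-1)
  (* data distribution rho on X x Y *)
  (rho : probability (X * pdiscr y0)%type R)
  (* f* minimizes E over measurable f : X -> Z *)
  (fstar : X -> Z) (Hfstar_m : measurable_fin fstar)
  (Hfstar_opt : forall f : X -> Z, measurable_fin f ->
     (\int[rho]_p (Lloss psi phi c (fstar p.1) p.2)%:E <=
      \int[rho]_p (Lloss psi phi c (f p.1) p.2)%:E)%E)
  (* scalar RKHS Gbar with kernel kk bounded by kappa^2 *)
  (Hs : set (X -> R)) (ip : (X -> R) -> (X -> R) -> R) (kk : X -> X -> R)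
  (Hrkhs : is_rkhs Hs ip kk)
  (Hkk_m : measurable_fun setT (fun p : X * X => kk p.1 p.2))
  (kappa : R) (Hkappa : 0 < kappa) (Hkk_b : forall x, kk x x <= kappa ^+ 2)
  (* g* minimizes R over measurable g, g* in G with ||g*||_G <= D *)
  (D : R) (HD : 0 < D)
  (gstar : X -> 'rV[R]_k) (Hgstar_m : measurable_vec gstar)
  (Hgstar_opt : forall g : X -> 'rV[R]_k, measurable_vec g ->
     (\int[rho]_p (Sloss Dom h phi (gstar p.1) p.2)%:E <=
      \int[rho]_p (Sloss Dom h phi (g p.1) p.2)%:E)%E)
  (Hgstar_G : inG Hs gstar) (Hgstar_D : normG ip gstar <= D)
  (* n i.i.d. samples (xi 0, ..., xi (n-1)) from rho *)
  (n : nat) (Hn : (0 < n)%N)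
  (dO : measure_display) (Om : measurableType dO) (P : probability Om R)
  (xi : nat -> Om -> (X * pdiscr y0)%type)
  (Hxi_m : forall i, measurable_fun setT (xi i))
  (Hxi_law : forall i (A : set (X * pdiscr y0)%type), (i < n)%N -> measurable A ->
     P (xi i @^-1` A) = rho A)
  (Hxi_indep : indep_first P xi n) :
  let gradhs := grad (fconj Dom h) in
  let C := Num.sqrt (1 + sup [set norm2 (phi y - gradhs 0) | y in [set: Y]]
                          / (kappa * beta * D)) in
  let eta := 2 / (beta * kappa ^+ 2 * C ^+ 2 * Num.sqrt n%:R) in
  let cpsi := \big[Num.max/0]_(z : Z) norm2 (psi z) in
  let gradS := fun (v : 'rV[R]_k) (y : Y) => gradhs v - phi y in
  let ghat := fun w => asgd_avg ip kk D eta gradS (fun i => xi i w) n in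
  let riskE := fun f : X -> Z => (\int[rho]_p (Lloss psi phi c (f p.1) p.2)%:E)%E in
  (\int[P]_w (riskE (legendre_decode z0 psi Dom h \o ghat w) - riskE fstar)
     <= (4 * kappa * cpsi * beta * D * C / (n%:R `^ (4^-1)))%:E)%E.
Proof.
pose gradhs := grad (fconj Dom h).
pose S := sup [set norm2 (phi y - gradhs 0) | y in [set: Y]].
pose C := Num.sqrt (1 + S / (kappa * beta * D)).
pose eta := 2 / (beta * kappa ^+ 2 * C ^+ 2 * Num.sqrt n%:R).
pose cpsi := \big[Num.max/0]_(z : Z) norm2 (psi z).
pose gradS := fun (v : 'rV[R]_k) (y : Y) => gradhs v - phi y.
pose ghat := fun w => asgd_avg ip kk D eta gradS (fun i => xi i w) n.
pose riskE := fun f : X -> Z => (\int[rho]_p (Lloss psi phi c (f p.1) p.2)%:E)%E.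
change (\int[P]_w (riskE (legendre_decode z0 psi Dom h \o ghat w) - riskE fstar)
     <= (4 * kappa * cpsi * beta * D * C / (n%:R `^ (4^-1)))%:E)%E.
have Dom0 : Dom !=set0.
  exists (phi y0); apply: HM; exists (fun y => (y == y0)%:R); split; first by move=> y.
  split; first by rewrite (bigD1 y0)//= eqxx big1 ?addr0// => y /negbTE ->.
  rewrite (bigD1 y0)//= eqxx scale1r big1 ?addr0// => y /negbTE ->.
  by rewrite scale0r.
have Dconv : convex_setv Dom by case: Hleg.
have n0' : (0 : R) < n%:R by rewrite ltr0n.
have kbD : 0 < kappa * beta * D by rewrite !mulr_gt0.
have S_ge y : norm2 (phi y - gradhs 0) <= S.
  apply: ub_le_sup; last by exists y.
  exists (\sum_y norm2 (phi y - gradhs 0)) => _ [z _ <-].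
  by rewrite (bigD1 z)//= lerDl sumr_ge0// => ? _; exact: norm2_ge0.
have S0 : 0 <= S := le_trans (norm2_ge0 _) (S_ge y0).
pose C2 := 1 + S / (kappa * beta * D).
have C21 : 1 <= C2 by rewrite lerDl divr_ge0// ltW.
have CE : C ^+ 2 = C2 by rewrite sqr_sqrtr// (le_trans ler01).
have C0 : 0 < C by rewrite sqrtr_gt0 (lt_le_trans ltr01).
have phi_le y : norm2 (phi y - gradhs 0) <= beta * kappa * D * (C2 - 1).
  have -> : beta * kappa * D * (C2 - 1) = S; last exact: S_ge.
  by rewrite /C2; field; rewrite !gt_eqF.
have etaE : eta = 2 / (beta * kappa ^+ 2 * C2 * Num.sqrt n%:R) by rewrite -CE.
have gs_le : ipG ip gstar gstar <= D ^+ 2 by rewrite -(normG_le_sqr Hrkhs HD).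
have gs_bmv := bmv_gs Hrkhs Hkappa Hkk_b HD Hgstar_m Hgstar_G gs_le.
pose it w i := asgd_iter ip kk D eta gradS (xi^~ w) i.
have bit i : bmv (fun z : Om * (X * pdiscr y0) => it z.1 i z.2.1).
  exact: (bmv_asgd_iter phi Dom0 Dconv Hconj_fin Hconj_diff Hbeta Hsc Hrkhs Hkk_m
    eta Hkappa Hkk_b HD (s := xi) (m := i) (fun j _ => Hxi_m j)).
(* Joint measurability serves the integral over [Om]; [bgh], for fixed samples, serves the risk of
   each predictor. *)
have bjoint : bmv (fun z : Om * (X * pdiscr y0) => ghat z.1 z.2.1).
  by apply: bmvZ; apply: bmv_sum => i; exact: (bit i.+1).
have bgh w : bmv (ghat w).
  apply: bmvZ; apply: bmv_sum => i.
  exact: (bmv_asgd_iter_path phi Dom0 Dconv Hconj_fin Hconj_diff Hbeta Hsc Hrkhs Hkk_m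
      eta Hkappa Hkk_b HD).
have bGh w := bmv_grad_fconj Dom0 Dconv Hconj_fin Hconj_diff Hbeta Hsc (bgh w).
have md w : measurable_fin (legendre_decode z0 psi Dom h \o ghat w).
  exact: (measurable_zdec z0 psi (bGh w).1).
(* The risks are finite, so the extended difference in the goal is a real one. *)
pose rE (f : X -> Z) : R := \int[rho]_p Lloss psi phi c (f p.1) p.2.
have riskEE f : measurable_fin f -> riskE f = (rE f)%:E.
  by move=> mf; apply: bmf_EFin; exact: bmf_Lloss.
pose ex w : R := rE (legendre_decode z0 psi Dom h \o ghat w) - rE fstar.
have bex : bmf ex.
  apply: bmfB; last exact: bmf_cst.
  apply: (@bmf_fubini_F _ _ _ Om Om _ R P rho (fun z =>
    Lloss psi phi c (legendre_decode z0 psi Dom h (ghat z.1 z.2.1)) z.2.2) (fun w => w)).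
    exact: measurable_id.
  apply: bmfD; last exact: bmf_cst.
  apply: bmv_dotv.
    apply: (@bmv_fin _ _ R k Z psi
      (fun z : Om * (X * pdiscr y0) => legendre_decode z0 psi Dom h (ghat z.1 z.2.1))).
    apply: (measurable_zdec z0 psi).
    exact: (bmv_grad_fconj Dom0 Dconv Hconj_fin Hconj_diff Hbeta Hsc bjoint).1.
  apply: (bmv_comp (f := fun p : X * pdiscr y0 => phi p.2)
    (a := fun z : Om * (X * pdiscr y0) => z.2)); first exact: measurable_snd.
  exact: bmv_phi.
have -> : (\int[P]_w (riskE (legendre_decode z0 psi Dom h \o ghat w) - riskE fstar) =
    (\int[P]_w ex w)%R%:E)%E.
  rewrite -bmf_EFin//; apply: eq_integral => w _.
  by rewrite !riskEE.
rewrite lee_fin.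
pose br := breg_risk phi Dom h rho ip kk D eta gstar xi.
(* The balancing value: [2 beta / t] times the expected divergence bound equals [t], for a total of
   [2 cpsi t]. *)
pose t : R := 2 * kappa * beta * D * C / (n%:R `^ (4^-1)).
have r0 : 0 < n%:R `^ (4^-1) :> R by exact: powR_gt0.
have t0 : 0 < t by rewrite divr_gt0// !mulr_gt0.
have bt0 : 0 <= 2 * beta / t by rewrite ltW// divr_gt0// mulr_gt0.
have cp0 : 0 <= cpsi := le_trans (norm2_ge0 (psi z0)) (cpsi_ge psi z0).
have bbr i : bmf (br i).
  exact: (bmf_breg_risk phi Dom0 Dconv Hconj_fin Hconj_diff Hbeta Hsc rho Hrkhs Hkk_m
    eta Hkappa Hkk_b HD Hgstar_m Hgstar_G gs_le P Hxi_m).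
have bavg : bmf (fun w => n%:R^-1 * \sum_(i < n) br i.+1 w).
  by apply: bmfZ; exact: bmf_sum.
have ex_le w : ex w <= cpsi * (t + 2 * beta / t * (n%:R^-1 * \sum_(i < n) br i.+1 w)).
  apply: le_trans (excess_risk_le z0 psi c Dom0 Dconv Hconj_fin Hconj_diff Hbeta Hsc
    gs_bmv Hgstar_opt (bgh w) Hfstar_m t0) _.
  rewrite ler_wpM2l// lerD2l ler_wpM2l//.
  have bp i : bmf (fun p : X * pdiscr y0 => bregman Dom h (it w i p.1) (gstar p.1)).
    exact: (bmf_breg_path y0 phi Dom0 Dconv Hconj_fin Hconj_diff Hbeta Hsc Hrkhs Hkk_m
      eta Hkappa Hkk_b HD Hgstar_m Hgstar_G gs_le).
  have bps : bmf (fun p : X * pdiscr y0 =>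
      \sum_(i < n) bregman Dom h (it w i.+1 p.1) (gstar p.1)).
    by apply: bmf_sum => i; exact: (bp i.+1).
  have -> : n%:R^-1 * (\sum_(i < n) br i.+1 w) =
      \int[rho]_p (n%:R^-1 * \sum_(i < n) bregman Dom h (it w i.+1 p.1) (gstar p.1)).
    by rewrite bmf_intZ// bmf_int_sum// => i; exact: (bp i.+1).
  apply: bmf_int_le.
  - by apply: (bmf_bregman Dom0 Dconv Hconj_fin Hconj_diff Hbeta Hsc); exact: bmv_fst.
  - exact: bmfZ.
  - by move=> p; exact: (bregman_avg Dom0 Hconj_fin Hconj_diff).
have avg_le := expected_bregman_le Dom0 Dconv Hconj_fin Hconj_diff Hbeta Hsc Hrkhs Hkk_m
  Hkappa Hkk_b HD Hgstar_m Hgstar_opt Hgstar_G gs_le Hn C21 phi_le etaE Hxi_m Hxi_law Hxi_indep.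
apply: (@le_trans _ _ (cpsi * (t + 2 * beta / t *
    (2 * (beta * kappa ^+ 2) * D ^+ 2 * C2 / Num.sqrt n%:R)))).
  apply: (@le_trans _ _ (\int[P]_w (cpsi * (t + 2 * beta / t *
      (n%:R^-1 * \sum_(i < n) br i.+1 w))))).
    apply: bmf_int_le => //.
    by apply: bmfZ; apply: bmfD; [exact: bmf_cst|exact: bmfZ].
  rewrite bmf_intZ; last by apply: bmfD; [exact: bmf_cst|exact: bmfZ].
  rewrite bmf_intD; [|exact: bmf_cst|exact: bmfZ].
  rewrite bmf_int_cst bmf_intZ// bmf_intZ; last exact: bmf_sum.
  by rewrite bmf_int_sum// ler_wpM2l// lerD2l ler_wpM2l.
have rE2 : Num.sqrt n%:R = (n%:R `^ (4^-1)) ^+ 2 :> R.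
  rewrite -powR12_sqrt// -powR_mulrn ?powR_ge0// -powRrM; congr (_ `^ _); lra.
rewrite rE2 -CE /t; move: (n%:R `^ (4^-1)) r0 => r r0.
rewrite le_eqVlt; apply/orP; left; apply/eqP; field.
by rewrite !gt_eqF.
Qed.
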